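(* There are absolute constants $c$ and $\kappa$ such that for every integer $d\ge 1$, every projective surface $X\subset\mathbb{P}^3_{\mathbb{Q}}$ of degree $d$ and every real $B\ge 2$ one has $$\#X(\mathbb{Q},B)\le c\,d^{\frac{3}{4}}B^3(\log B)^{\kappa}.$$
   Context: A variety in $\mathbb{P}^n_{\mathbb{Q}}$ is a reduced (closed) subscheme of $\mathbb{P}^n_{\mathbb{Q}}$, not necessarily irreducible; a surface is a variety of pure dimension $2$, and its degree is the sum of the degrees of its irreducible components. $X(\mathbb{Q},B)$ denotes the set of rational points of $X$ of height $\le B$, i.e. the points that can be written in homogeneous integer coordinates $(x_0,\dots,x_n)$ (not all zero) with $|x_0|,\dots,|x_n|\le B$. *)

(* Defs.v *)
From mathcomp Require Export all_boot all_order all_algebra.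
From mathcomp Require Export finmap boolp classical_sets functions cardinality fsbigop.
From mathcomp Require Export reals exp.
From mathcomp Require Export ring_quotient.
From mathcomp Require Export mpoly.

Set Implicit Arguments.
Unset Strict Implicit.
Unset Printing Implicit Defensive.

Import Order.TTheory GRing.Theory Num.Theory.

Local Open Scope classical_set_scope.
Local Open Scope ring_scope.

(** Closed subschemes of P^n over Q are encoded by their homogeneous saturated
    ideals in Q[x_0, ..., x_n]; such a subscheme is reduced exactly when this
    ideal is radical. *)

Section Varieties.
Variable n : nat.
Local Notation S := {mpoly rat[n.+1]}.

(* [idealr_closed] includes properness, so the ideal (1) of the empty scheme is
   left out; the empty scheme has degree 0. *)
Definition homogeneous_ideal (I : set S) :=
  idealr_closed (mem I) /\ forall f m, I f -> I (pihomog mdeg m f).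

Definition radical_ideal (I : set S) := forall f k, I (f ^+ k) -> I f.

Definition saturated_ideal (I : set S) :=
  forall f, (forall i : 'I_n.+1, I ('X_i * f)) -> I f.

Definition variety (I : set S) :=
  [/\ homogeneous_ideal I, saturated_ideal I & radical_ideal I].

(* The points of the scheme Proj S, i.e. the nonempty irreducible closed
   subsets of P^n: homogeneous primes not containing (x_0, ..., x_n). *)
Definition proj_prime (P : set S) :=
  [/\ homogeneous_ideal P, prime_idealr_closed (mem P)
    & exists i : 'I_n.+1, ~ P 'X_i].

Definition irreducible_components (I : set S) : set (set S) :=
  [set P | [/\ proj_prime P, I `<=` P
    & forall Q, proj_prime Q -> I `<=` Q -> Q `<=` P -> Q = P]].

(* Chains of irreducible closed subsets of V(I), read in the opposite order. *)
Definition prime_chain (I : set S) (r : nat) :=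
  exists c : nat -> set S,
    (forall i, (i <= r)%N -> proj_prime (c i) /\ I `<=` c i) /\
    (forall i, (i < r)%N -> c i `<` c i.+1).

(* Krull dimension of V(I). *)
Definition dimension (I : set S) : nat :=
  xget 0%N [set r | prime_chain I r /\
                    forall k, prime_chain I k -> (k <= r)%N].

Definition graded_part (I : set S) (m : nat) : {vspace dhomog n.+1 rat m} :=
  xget 0%VS [set V | forall f : dhomog n.+1 rat m, f \in V <-> I (val f)].

Definition hilbert_function (I : set S) (m : nat) : nat :=
  (\dim {: dhomog n.+1 rat m} - \dim (graded_part I m))%N.

Definition hilbert_poly (I : set S) : {poly rat} :=
  xget 0 [set h : {poly rat} | exists N, forall m, (N <= m)%N ->
                                 h.[m%:R] = (hilbert_function I m)%:R].

Definition irreducible_degree (P : set S) : rat :=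
  (dimension P)`!%:R * lead_coef (hilbert_poly P).

Definition degree (I : set S) : rat :=
  \sum_(P \in irreducible_components I) irreducible_degree P.

Definition pure_dimension (I : set S) (r : nat) :=
  forall P, irreducible_components I P -> dimension P = r.

Definition surface (I : set S) := variety I /\ pure_dimension I 2.

(* P^n(Q) is the set of lines of Q^(n+1). *)
Definition rational_points (I : set S) : set {vspace 'rV[rat]_n.+1} :=
  [set p | \dim p = 1%N /\
           forall v : 'rV[rat]_n.+1, v \in p -> forall f, I f -> f.@[fun i => v 0 i] = 0].

Definition height_le (R : realType) (B : R) : set {vspace 'rV[rat]_n.+1} :=
  [set p | exists x : 'rV[int]_n.+1,
     [/\ x != 0, p = <[map_mx intr x]>%VS & forall i, `|x 0 i|%:~R <= B]].

Definition rational_points_le (R : realType) (I : set S) (B : R) :=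
  rational_points I `&` height_le B.

End Varieties.

(* Main.v *)
Require Import Defs.
From HB Require Import structures.
From mathcomp Require Import zify lra.
Set Implicit Arguments.
Unset Strict Implicit.
Unset Printing Implicit Defensive.

Import Order.TTheory GRing.Theory Num.Theory.
Local Open Scope classical_set_scope.
Local Open Scope ring_scope.

(** The proof is elementary, and it yields the bound with no logarithm at all
    (exponent kappa = 0).

    From the scheme to a form.  All that is used of the surface X is that its
    rational points are zeros of a nonzero form F of degree d ([surface_form]).
    Unique factorization in Q[x_0, ..., x_3] shows that a homogeneous prime of
    dimension 2 is generated by a form G ([dimension2_principal]); otherwise it
    would contain a smaller nonzero homogeneous prime (G), and the resulting
    chain of five homogeneous primes is too long, because the growth exponent of
    the Hilbert function drops at each step ([no_long_chain]).  The Hilbert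
    polynomial of (G) has leading coefficient deg G / 2, so the degrees of the
    generators of the irreducible components add up to d, and F is the product of
    these generators.  The ideal of a point of X is a homogeneous prime, hence
    contains a component ([below_component]), hence F vanishes there.

    From a form to a count.  Let N be the integral part of B, and let M and H be
    about N^(1/3) and d^(1/4).  By the pigeonhole principle an integer point x
    with coordinates at most N is orthogonal to a nonzero integer vector of sup
    norm at most 2 M; let a, of norm A, be a shortest one.  Points are sorted
    according to a.

    If F does not vanish on the plane a^perp, a second pigeonhole argument gives a
    vector b orthogonal to x, independent of a, reduced modulo a and of size about
    (N/A)^(1/2).  So x lies on one of O(A (N/A)^(3/2)) lines.  A line on which F is
    not identically zero carries at most d points of X.  At most d lines of
    the plane lie in the zero set, and each carries O(N^2/A^2) points, since two
    points of a line have a minor of size at least A^2/4: otherwise a vector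
    shorter than a would be orthogonal to both ([short_line_count]).  Summing over
    the O(A^3) vectors a of norm A, and over A <= 2 M, gives
    O(d M^2 N^2) = O(d N^(8/3)) points ([class_bound], [count_off_planes]).

    At most d planes lie in the zero set, and the plane a^perp has O(N^3/A) integer
    points in the box ([plane_count]).  As O(A^3) vectors have norm A, the sum of
    1/A over d distinct vectors is O(H^3) = O(d^(3/4)), so these planes contribute
    O(d^(3/4) N^3) points.  This is the main term, and it is attained when X is the
    union of the d planes of smallest height.

    Finally d N^(8/3) <= d^(3/4) N^3 unless d > N^(4/3), and then the trivial bound
    O(N^4) is good enough ([root_bounds]). *)

(** * Unique factorization in polynomial rings *)

Section Factorial.
Variable A : idomainType.
Implicit Types a b p : A.

Definition divides a b := exists c, b = a * c.

Definition prime_elt p :=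
  [/\ p != 0, p \isn't a GRing.unit
    & forall a b, divides p (a * b) -> divides p a \/ divides p b].

(** The factors are prime and not merely irreducible, so uniqueness is built in. *)
Definition is_factorial :=
  forall a, a != 0 -> exists (u : A) (s : seq A),
    [/\ u \is a GRing.unit, forall p, p \in s -> prime_elt p
      & a = u * \prod_(p <- s) p].

Lemma prime_divides_prod p (s : seq A) :
  prime_elt p -> divides p (\prod_(q <- s) q) -> exists2 q, q \in s & divides p q.
Proof.
move=> pp; elim: s => [|q s IHs].
  rewrite big_nil => -[c /esym pc]; case: pp => _ /negP pu _; case: pu.
  by apply/unitrPr; exists c.
rewrite big_cons; case: (pp) => _ _ ppr /ppr[pq|/IHs[r rs pr]].
  by exists q; rewrite ?mem_head.
by exists r; rewrite ?in_cons ?rs ?orbT.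
Qed.

Lemma prime_divides_prime p q : prime_elt p -> prime_elt q -> divides p q ->
  exists2 v, v \is a GRing.unit & q = p * v.
Proof.
move=> [p0 pu _] [q0 qu qpr] [v qE]; exists v => //.
have : divides q (p * v) by exists 1; rewrite mulr1.
case/qpr=> -[w wE].
  have : v * w = 1.
    by apply: (mulfI p0); rewrite mulrA -qE -wE mulr1.
  by move=> vw; apply/unitrPr; exists w.
have : p * w = 1.
  by apply: (mulfI q0); rewrite mulrA (mulrC q) -mulrA -wE -qE mulr1.
by move=> pw; case/negP: pu; apply/unitrPr; exists w.
Qed.

End Factorial.

Section Gauss.
Variable A : idomainType.
Hypothesis factA : is_factorial A.
Implicit Types (a c p : A) (f g h : {poly A}).

(** Gauss's lemma.  The prime divides the product of the two leading coefficients,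
    hence one of them; the corresponding leading term can then be removed, which
    makes the two polynomials smaller. *)
Lemma prime_polyC p : prime_elt p -> prime_elt p%:P.
Proof.
move=> [p0 pu ppr]; split; first by rewrite polyC_eq0.
  by apply: contra pu => /andP[_]; rewrite coefC.
move=> f g; have [n] := ubnP (size f + size g); elim: n f g => // n IHn f g.
have [->|f0] := eqVneq f 0; first by move=> *; left; exists 0; rewrite mulr0.
have [->|g0] := eqVneq g 0; first by move=> *; right; exists 0; rewrite mulr0.
move=> sn [c cE].
have cut (k : {poly A}) : k != 0 ->
    (size (k - (lead_coef k) *: 'X^((size k).-1))%R < size k)%N.
  move=> k0; have sk : (0 < size k)%N by rewrite size_poly_gt0.
  rewrite -[X in (_ < X)%N](prednK sk) ltnS; apply/leq_sizeP => j.
  rewrite leq_eqVlt => /predU1P[<-|ltj].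
    by rewrite coefB coefZ coefXn eqxx mulr1 lead_coefE subrr.
  rewrite coefB coefZ coefXn gtn_eqF // mulr0 subr0 nth_default //.
  by rewrite -(prednK sk).
have : divides p (lead_coef f * lead_coef g).
  by exists (lead_coef c); rewrite -lead_coefM cE lead_coefM lead_coefC.
have step (k l d : {poly A}) : (l * k = p%:P * d) -> divides p (lead_coef k) ->
    exists2 k', (k' = k - (lead_coef k) *: 'X^((size k).-1)) &
     divides p%:P (l * k') /\ (divides p%:P k' -> divides p%:P k).
  move=> lk [e eE]; exists (k - lead_coef k *: 'X^((size k).-1)) => //; split.
    exists (d - l * (e *: 'X^((size k).-1))).
    by rewrite !mulrBr lk; congr (_ - _); rewrite eE -!mul_polyC polyCM -!mulrA mulrCA.
  case=> m mE; exists (m + e *: 'X^((size k).-1)).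
  by rewrite mulrDr -mE eE -!mul_polyC polyCM mulrA subrK.
case/ppr=> pl.
  have [f' f'E [dv im]] := step f g c (etrans (mulrC _ _) cE) pl.
  rewrite mulrC in dv; case: (IHn f' g _ dv); [|by left; apply: im|by right].
  rewrite (leq_trans _ (_ : size f + size g <= n)%N) //.
  by rewrite ltn_add2r f'E cut.
have [g' g'E [dv im]] := step g f c cE pl.
case: (IHn f g' _ dv); [|by left|by right; apply: im].
rewrite (leq_trans _ (_ : size f + size g <= n)%N) //.
by rewrite ltn_add2l g'E cut.
Qed.

(** A factorization over the fraction field descends to the ring: the primes of the
    denominator [a] are cancelled one at a time, each against the factor that it
    divides. *)
Lemma gauss_mul a f g h : a != 0 -> a%:P * f = g * h ->
  exists g' h', [/\ f = g' * h', size g' = size g & size h' = size h].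
Proof.
move=> /factA[u [s [uu ps ->]]]; elim: s g h ps => [|p s IHs] g h ps.
  rewrite big_nil mulr1 => E; exists (u^-1 *: g), h; split=> //.
    by rewrite -scalerAl -E mul_polyC scalerA mulVr // scale1r.
  by rewrite size_scale // invr_eq0; apply: contraTneq uu => ->; rewrite unitr0.
have pp := ps p (mem_head _ _).
have ps' q : q \in s -> prime_elt q by move=> qs; apply: ps; rewrite in_cons qs orbT.
have p0 : p != 0 by case: pp.
have pP0 : p%:P != 0 by rewrite polyC_eq0.
rewrite big_cons mulrCA polyCM -mulrA => E.
have : divides p%:P (g * h) by exists ((u * \prod_(q <- s) q)%:P * f); rewrite -E.
case: (prime_polyC pp) => _ _ H /H[] -[k kE].
  have [|g' [h' [fE sg sh]]] := IHs k h ps'.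
    by apply: (mulfI pP0); rewrite E kE mulrA.
  exists g', h'; split=> //.
  by rewrite sg kE mul_polyC size_scale.
have [|g' [h' [fE sg sh]]] := IHs g k ps'.
  by apply: (mulfI pP0); rewrite E kE mulrCA.
exists g', h'; split=> //.
by rewrite sh kE mul_polyC size_scale.
Qed.

Definition primitive f := forall p, prime_elt p -> ~ divides p%:P f.

(** The primes of [a] are again cancelled one at a time; a primitive [g] absorbs none
    of them, so that all of them divide the quotient. *)
Lemma gauss_divides a f g h : primitive g -> a != 0 -> a%:P * f = g * h -> divides g f.
Proof.
move=> prim /factA[u [s [uu ps ->]]]; elim: s h ps => [|p s IHs] h ps.
  rewrite big_nil mulr1 => E; exists (u^-1 *: h).
  by rewrite -scalerAr -E mul_polyC scalerA mulVr // scale1r.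
have pp := ps p (mem_head _ _).
have ps' q : q \in s -> prime_elt q by move=> qs; apply: ps; rewrite in_cons qs orbT.
have pP0 : p%:P != 0 by rewrite polyC_eq0; case: pp.
rewrite big_cons mulrCA polyCM -mulrA => E.
have : divides p%:P (g * h) by exists ((u * \prod_(q <- s) q)%:P * f); rewrite -E.
case: (prime_polyC pp) => _ _ H /H[/prim[] //|[k kE]].
apply: (IHs k) => //; apply: (mulfI pP0); by rewrite E kE mulrCA.
Qed.

(** Constant prime factors are split off until none is left.  Each of them uses up
    one prime of the leading coefficient, so the process stops. *)
Lemma content_primitive f : f != 0 ->
  exists c g, [/\ c != 0, primitive g & f = c%:P * g].
Proof.
move=> f0; have /factA[u [s [uu ps]]] : lead_coef f != 0 by rewrite lead_coef_eq0.
have [n] := ubnP (size s); elim: n f f0 u s uu ps => // n IHn f f0 u s uu ps sn lE.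
have [prim|] := pselect (primitive f).
  by exists 1, f; rewrite oner_eq0 mul1r.
move/existsNP=> [p /not_implyP[pp /contrapT[f' f'E]]].
have f'0 : f' != 0 by apply: contraNneq f0 => f'0; rewrite f'E f'0 mulr0.
have p0 : p != 0 by case: pp.
have lE' : lead_coef f = p * lead_coef f' by rewrite f'E lead_coefM lead_coefC.
have : divides p (u * \prod_(q <- s) q) by exists (lead_coef f'); rewrite -lE.
case: (pp) => _ pu H /H[[w wE]|].
  case/negP: pu; apply/unitrPr; exists (w * u^-1).
  by rewrite mulrA -wE mulrV.
case/(prime_divides_prod pp)=> q qs.
case/(prime_divides_prime pp (ps q qs)) => v vu qE.
have [||||c [g [c0 primg f'gE]]] := IHn f' f'0 (u * v) (rem q s).
- by rewrite unitrM uu.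
- by move=> r /mem_rem/ps.
- have s0 : (0 < size s)%N by case: (s) qs.
  by rewrite size_rem // -ltnS prednK.
- by apply: (mulfI p0); rewrite -lE' lE (big_rem _ qs) /= {1}qE !mulrA (mulrC p).
exists (p * c), g; rewrite mulf_neq0 //; split => //.
by rewrite f'E f'gE polyCM mulrA.
Qed.

(** [irreducible_poly] and [%|] over a domain are irreducibility and divisibility over
    its fraction field, where Euclid's lemma holds; [gauss_divides] brings the
    conclusion back to the ring. *)
Lemma irreducible_prime f : primitive f -> irreducible_poly f -> prime_elt f.
Proof.
move=> prim irr; have f0 := irredp_neq0 irr; have [s1 irrf] := irr.
have pseudo g : f %| g -> divides f g.
  case/Pdiv.Idomain.dvdpP=> -[c q] /= c0 cE.
  by apply: (gauss_divides (h := q) prim c0); rewrite mul_polyC mulrC.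
split=> //.
  apply/negP => /andP[/eqP sf _]; by rewrite sf in s1.
move=> g h [k kE]; have /orP := orbN (f %| g); case=> [fg|fg]; first by left; apply: pseudo.
right; apply: pseudo; rewrite -(@Gauss_dvdpr _ h g) ?kE ?dvdp_mulIl //.
rewrite coprimep_def; apply: contraNT fg => sz.
have /eqp_dvdl <- := irrf _ sz (dvdp_gcdl f g); exact: dvdp_gcdr.
Qed.

Lemma factorial_poly : is_factorial {poly A}.
Proof.
move=> f; have [n] := ubnP (size f); elim: n f => // n IHn f sn f0.
have [c [g [c0 primg fE]]] := content_primitive f0.
have [u [s [uu ps cE]]] := factA c0.
have g0 : g != 0 by apply: contraNneq f0 => g0; rewrite fE g0 mulr0.
have sg : size f = size g by rewrite fE mul_polyC size_scale.
have [v [t [vu pt gE]]] : exists (v : {poly A}) (t : seq {poly A}),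
    [/\ v \is a GRing.unit, forall q : {poly A}, q \in t -> prime_elt q
      & g = v * \prod_(q <- t) q].
  have [sg1|sg1] := leqP (size g) 1.
    have gC := size1_polyC sg1; have e0 : g`_0 != 0 by rewrite -polyC_eq0 -gC.
    have [v [[|p t] [vu pt gE]]] := factA e0.
      exists v%:P, [::]; rewrite big_nil mulr1; split => //.
        exact: rmorph_unit.
      by rewrite gC gE big_nil mulr1.
    case: (primg p); first exact: pt (mem_head _ _).
    by rewrite gC gE big_cons; exists (v * \prod_(j <- t) j)%:P; rewrite mulrCA polyCM.
  have [irr|] := pselect (irreducible_poly g).
    exists 1, [:: g]; rewrite unitr1 big_seq1 mul1r; split=> // p.
    by rewrite inE => /eqP ->; apply: irreducible_prime.
  move/not_andP=> [//|/existsNP[q /not_implyP[/eqP qs1 /not_implyP[qg /negP qNg]]]].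
  have qlt : (size q < size g)%N.
    rewrite ltn_neqAle dvdp_leq // andbT; apply: contra qNg.
    by rewrite (dvdp_size_eqp qg).
  case/Pdiv.Idomain.dvdpP: qg => -[a k] /= a0 /esym; rewrite -mul_polyC => /esym.
  case/(gauss_mul a0)=> k' [q' [gE _ sq]].
  have k'0 : k' != 0 by apply: contraNneq g0 => e; rewrite gE e mul0r.
  have q'0 : q' != 0 by apply: contraNneq g0 => e; rewrite gE e mulr0.
  have szE := size_mul k'0 q'0; rewrite -gE in szE.
  have sk0 : (0 < size k')%N by rewrite size_poly_gt0.
  have sq0 : (0 < size q')%N by rewrite size_poly_gt0.
  have sq1 : (1 < size q')%N by lia.
  have [|//|v1 [t1 [u1 p1 e1]]] := IHn k'; first by lia.
  have [|//|v2 [t2 [u2 p2 e2]]] := IHn q'; first by lia.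
  exists (v1 * v2), (t1 ++ t2); rewrite unitrM u1 u2 big_cat /=; split=> //.
    by move=> p; rewrite mem_cat => /orP[/p1|/p2].
  by rewrite gE {1}e1 {1}e2 mulrACA.
exists (u%:P * v), ([seq p%:P | p <- s] ++ t); split.
- by rewrite unitrM vu andbT rmorph_unit.
- by move=> p; rewrite mem_cat => /orP[/mapP[q /ps pq ->]|/pt//]; apply: prime_polyC.
- by rewrite big_cat big_map /= fE gE cE polyCM rmorph_prod /= mulrACA.
Qed.

End Gauss.

Lemma factorial_transfer (A B : idomainType) (f : {rmorphism B -> A}) (g : A -> B) :
  cancel f g -> cancel g f -> is_factorial A -> is_factorial B.
Proof.
move=> fK gK factA b b0.
have gM : {morph g : x y / x * y} by move=> x y; rewrite -[x]gK -[y]gK -rmorphM !fK.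
have g1 : g 1 = 1 by rewrite -(rmorph1 f) fK.
have g0 : g 0 = 0 by rewrite -(rmorph0 f) fK.
have gunit x : x \is a GRing.unit -> g x \is a GRing.unit.
  by move=> /unitrPr[y xy]; apply/unitrPr; exists (g y); rewrite -gM xy.
have gdiv x y : divides x y -> divides (g x) (g y).
  by case=> z ->; exists (g z); rewrite gM.
have fb0 : f b != 0 by rewrite -(rmorph0 f) (can_eq fK).
have [u [s [uu ps fbE]]] := factA _ fb0.
exists (g u), (map g s); split.
- exact: gunit.
- move=> _ /mapP[p /ps[p0 pu ppr] ->]; split.
  + by rewrite -g0 (can_eq gK).
  + by apply: contra pu => /(rmorph_unit f); rewrite gK.
  + move=> x y [z zE].
    have : divides p (f x * f y) by exists (f z); rewrite -rmorphM zE rmorphM gK.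
    by case/ppr=> /gdiv; rewrite fK; [left|right].
- rewrite -[LHS]fK fbE gM big_map; congr (_ * _).
  by apply: (big_morph g gM g1).
Qed.

Section Uni.
Variables (n : nat) (R : idomainType).
Implicit Type p : {mpoly R[n.+1]}.
Local Notation widen := (widen_ord (leqnSn n)).

(** The inverse of [muni]. *)
Definition multi (q : {poly {mpoly R[n]}}) : {mpoly R[n.+1]} :=
  (map_poly (@mwiden n R) q).['X_ord_max].

Lemma muniX (m : 'X_{1..n.+1}) :
  muni 'X_[R, m] = 'X_[[multinom (m (widen i)) | i < n]] *: 'X^(m ord_max).
Proof. by rewrite muniE msuppX big_seq1 mcoeffX eqxx scale1r. Qed.

Lemma multiX (m : 'X_{1..n.+1}) :
  mwiden 'X_[R, [multinom (m (widen i)) | i < n]] * 'X_ord_max ^+ (m ord_max) = 'X_[m].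
Proof.
rewrite mwidenX mpolyXn -mpolyXD; congr 'X_[_]; apply/mnmP => i.
rewrite mnmDE mulmnE mnm1E; case: (unliftP ord_max i) => [j|] ->.
  have -> : lift ord_max j = widen j by apply: val_inj; rewrite /= /bump leqNgt ltn_ord.
  rewrite mnmwiden_widen mnmE; case: eqVneq => [/(congr1 val)/= e|_]; last by rewrite addn0.
  by have := ltn_ord j; rewrite -e ltnn.
by rewrite mnmwiden_ordmax eqxx mul1n.
Qed.

Lemma muniK : cancel (@muni n R) multi.
Proof.
move=> p; rewrite /multi muniE !(rmorph_sum, horner_sum) /=.
rewrite [RHS]mpolyE; apply: eq_bigr => m _.
rewrite -!mul_polyC !(rmorphM, hornerM) /= !map_polyC !hornerC map_polyXn hornerXn /=.
by rewrite -mul_mpolyC mwidenM mwidenC -mulrA multiX mul_mpolyC.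
Qed.

Lemma muni_mwiden (q : {mpoly R[n]}) : muni (mwiden q) = q%:P.
Proof.
elim/mpolyind: q => [|c m q _ _ IHq]; first by rewrite mwiden0 muni0.
rewrite mwidenD muniD IHq polyCD; congr (_ + _).
rewrite mwidenZ muniZ mwidenX muniX mnmwiden_ordmax expr0 alg_polyC -mul_polyC -polyCM.
rewrite mul_mpolyC; congr (_ *: 'X_[_])%:P; apply/mnmP => i.
by rewrite mnmE mnmwiden_widen.
Qed.

Lemma muniXmax : muni 'X_(@ord_max n) = 'X :> {poly {mpoly R[n]}}.
Proof.
rewrite muniX mnm1E eqxx expr1 (_ : [multinom _ | i < n] = 0%MM) ?mpolyX0 ?scale1r //.
apply/mnmP => i; rewrite mnmE mnm0E mnm1E; case: eqVneq => // /(congr1 val)/= e.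
by have := ltn_ord i; rewrite -e ltnn.
Qed.

Lemma multiK : cancel multi (@muni n R).
Proof.
apply: poly_ind => [|q c IHq]; first by rewrite /multi rmorph0 horner0 muni0.
rewrite /multi rmorphD rmorphM /= map_polyX map_polyC hornerD hornerC hornerMX /=.
by rewrite muniD muniM muni_mwiden muniXmax -/(multi q) IHq.
Qed.

Lemma meval_muni p (v : 'I_n.+1 -> R) :
  p.@[v] = (map_poly (meval (v \o widen)) (muni p)).[v ord_max].
Proof.
elim/mpolyind: p => [|c m p _ _ IHp]; first by rewrite meval0 muni0 rmorph0 horner0.
rewrite mevalD IHp muniD rmorphD hornerD; congr (_ + _).
rewrite mevalZ mevalX muniZ muniX -!mul_polyC.
rewrite !(rmorphM, hornerM) /= !map_polyC !hornerC map_polyXn hornerXn /=.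
rewrite mevalC mevalX big_ord_recr /=; congr (_ * (_ * _)).
by apply: eq_bigr => i _; rewrite mnmE.
Qed.
End Uni.

Lemma factorial_mpoly (F : fieldType) n : is_factorial {mpoly F[n]}.
Proof.
elim: n => [|n IHn]; last first.
  exact: factorial_transfer (@muniK n F) (@multiK n F) (factorial_poly IHn).
move=> a a0; exists a, [::]; split=> //; last by rewrite big_nil mulr1.
rewrite -[a]mpolyKC; apply: rmorph_unit; rewrite unitfE.
by apply: contraNneq a0 => e; rewrite -[a]mpolyKC e mpolyC0.
Qed.

Lemma poly_nonroot (q : {poly rat}) : q != 0 -> exists t, q.[t] != 0.
Proof.
move=> q0; apply: contrapT => H.
have := @max_poly_roots _ q (map (fun k : nat => k%:R) (iota 0 (size q))) q0.
rewrite size_map size_iota ltnn => H'; suff : false by [].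
apply: H'; last first.
  by rewrite map_inj_uniq ?iota_uniq //; apply: mulrIn; rewrite oner_eq0.
by apply/allP => t _; apply: contrapT => nt; apply: H; exists t; apply/negP.
Qed.

(** By induction on the number of variables: a point where the leading coefficient
    in the last variable is nonzero leaves a nonzero univariate polynomial. *)
Lemma mpoly_nonvanishing n (p : {mpoly rat[n]}) : p != 0 -> exists v, p.@[v] != 0.
Proof.
elim: n p => [|n IHn] p p0.
  exists (fun=> 0); rewrite -[p]mpolyKC mevalC.
  by apply: contraNneq p0 => e; rewrite -[p]mpolyKC e mpolyC0.
have q0 : muni p != 0 by apply: contraNneq p0 => e; rewrite -[p]muniK e /multi rmorph0 horner0.
have /IHn[v vE] : lead_coef (muni p) != 0 by rewrite lead_coef_eq0.
pose q := map_poly (meval v) (muni p).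
have q'0 : q != 0.
  apply: contraNneq vE => /(congr1 (coefp (size (muni p)).-1)) /=.
  by rewrite coef_map coef0 /= -lead_coefE => ->.
have [t rt] := poly_nonroot q'0.
exists (fun i => if insub (val i) is Some j then v j else t).
rewrite meval_muni (_ : _ \o _ = v) /=; last first.
  by apply/funext => i /=; rewrite insubT //= => lti; congr v; apply: val_inj.
by rewrite insubF ?ltnn //.
Qed.

(** * Hilbert functions and chains of homogeneous primes *)

(** The subspace is one of maximal dimension among those contained in [P]. *)
Lemma vspace_of_prop (K : fieldType) (V : vectType K) (P : V -> Prop) :
  P 0 -> (forall a u v, P u -> P v -> P (a *: u + v)) ->
  exists U : {vspace V}, forall v, v \in U <-> P v.
Proof.
move=> P0 PD.
pose dimok k := `[< exists U : {vspace V}, \dim U = k /\ forall v, v \in U -> P v >].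
have ex0 : exists k, dimok k.
  exists 0%N; apply/asboolP; exists 0%VS; rewrite dimv0; split=> // v.
  by rewrite memv0 => /eqP ->.
have bnd k : dimok k -> (k <= \dim {: V})%N.
  by move=> /asboolP[U [<- _]]; apply: dimvS; apply: subvf.
have [k /asboolP[U [dU UP]] kmax] := ex_maxnP ex0 bnd.
exists U => v; split; first exact: UP.
move=> Pv; have /kmax : dimok (\dim (U + <[v]>)%VS).
  apply/asboolP; exists (U + <[v]>)%VS; split=> // _ /memv_addP[u uU [w /vlineP[a ->] ->]].
  by rewrite addrC; apply: PD => //; apply: UP.
rewrite -dU => le; have /eqP -> : (U == U + <[v]>)%VS.
  by rewrite eqEdim addvSl.
by rewrite memvE addvSr.
Qed.

Section Graded.
Variable n : nat.
Local Notation S := {mpoly rat[n.+1]}.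
Implicit Types (I P Q : set S) (f g h : S) (m e : nat).

Lemma mem_memE I f : (f \in mem I) = `[< I f >].
Proof. by []. Qed.

Lemma hideal0 I : homogeneous_ideal I -> I 0.
Proof. by move=> [[/asboolP]]. Qed.

Lemma hideal1 I : homogeneous_ideal I -> ~ I 1.
Proof. by move=> [[_ /asboolPn]]. Qed.

Lemma hidealP I a f g : homogeneous_ideal I -> I f -> I g -> I (a * f + g).
Proof.
move=> [[_ _ ID] _] If Ig; by apply/asboolP; apply: ID; apply/asboolP.
Qed.

Lemma hidealD I f g : homogeneous_ideal I -> I f -> I g -> I (f + g).
Proof. by move=> hI If Ig; rewrite -[f]mul1r; apply: hidealP. Qed.

Lemma hidealM I a f : homogeneous_ideal I -> I f -> I (a * f).
Proof. by move=> hI If; rewrite -[_ * _]addr0; apply: hidealP => //; apply: hideal0. Qed.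

Lemma hideal_sum I (J : Type) (r : seq J) (Pr : pred J) (F : J -> S) :
  homogeneous_ideal I -> (forall j, Pr j -> I (F j)) -> I (\sum_(j <- r | Pr j) F j).
Proof.
by move=> hI H; apply: (big_ind I) => //; [apply: hideal0|move=> *; apply: hidealD].
Qed.

Lemma graded_partP I m (f : dhomog n.+1 rat m) : homogeneous_ideal I ->
  f \in graded_part I m <-> I (val f).
Proof.
move=> hI; rewrite /graded_part; case: xgetP => [V _ /(_ f)//|H].
have [||U UE] := @vspace_of_prop _ (dhomog n.+1 rat m) (fun f : dhomog n.+1 rat m => I (val f)).
- exact: hideal0.
- move=> a u v Iu Iv; rewrite /= -mul_mpolyC; exact: hidealP.
by case: (H U).
Qed.

(** In contrast with [proj_prime], membership of the variables is left open, so that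
    the growth estimates below apply before it is known. *)
Definition hprime P := homogeneous_ideal P /\ forall f g, P (f * g) -> P f \/ P g.

Lemma proj_prime_hprime P : proj_prime P -> hprime P.
Proof.
case=> hP pP _; split=> // f g fg; have := pP f g; rewrite !mem_memE => /(_ (introT (asboolP _) fg)).
by case/orP => /asboolP; [left|right].
Qed.

Lemma pihomog_notin I f : homogeneous_ideal I -> ~ I f ->
  exists e, ~ I (pihomog mdeg e f).
Proof.
move=> hI nIf; apply: contrapT => H; apply: nIf.
rewrite (pihomog_partitionE (leqnn (mmeasure mdeg f))).
apply: hideal_sum => // d _; apply: contrapT => K; apply: H; by exists d.
Qed.

Section Mulh.
Variables (m e : nat) (g : S).
Hypothesis hg : g \is e.-homog.
Definition mulh (f : dhomog n.+1 rat m) : dhomog n.+1 rat (m + e) :=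
  DHomog (dhomogM (dhomog_is_dhomog f) hg).
Fact mulh_is_linear : linear mulh.
Proof. by move=> a u v; apply: val_inj; rewrite /= mulrDl -scalerAl. Qed.
HB.instance Definition _ :=
  GRing.isLinear.Build rat (dhomog n.+1 rat m) (dhomog n.+1 rat (m + e)) _ mulh
    mulh_is_linear.

Lemma dim_mulh (U : {vspace dhomog n.+1 rat m}) : g != 0 ->
  \dim (linfun mulh @: U)%VS = \dim U.
Proof.
move=> g0; apply: limg_dim_eq; apply/eqP; rewrite -subv0; apply/subvP => f.
rewrite memv_cap memv_ker lfunE memv0 => /andP[_ /eqP/(congr1 val)/= /eqP].
by rewrite mulf_eq0 (negPf g0) orbF => /eqP e0; apply/eqP/val_inj.
Qed.

(** Multiplication by [g] is injective on S and also on S/P, hence the multiples of [g]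
    in [P] are the products of [g] with elements of [P]. *)
Lemma dim_add_mulh P : hprime P -> ~ P g ->
  (\dim (linfun mulh @: fullv + graded_part P (m + e))%VS + \dim (graded_part P m) =
   \dim {: dhomog n.+1 rat m} + \dim (graded_part P (m + e)))%N.
Proof.
move=> [hP pP] nPg; have g0 : g != 0.
  by apply: contra_notN nPg => /eqP ->; apply: hideal0.
rewrite -(dim_mulh fullv g0) -(dim_mulh (graded_part P m) g0) -(dimv_sum_cap (limg _)).
congr (_ + \dim _)%N; apply/eqP; rewrite eqEsubv; apply/andP; split.
  apply/subvP => _ /memv_imgP[f fP ->]; rewrite memv_cap memv_img ?memvf //=.
  apply/graded_partP => //; rewrite lfunE /= mulrC.
  apply: hidealM => //; exact/graded_partP.
apply/subvP => _ /memv_capP[/memv_imgP[f _ ->] /graded_partP H].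
apply: memv_img; apply/graded_partP => //; move: H; rewrite lfunE => /(_ hP) /=.
by case/pP.
Qed.
End Mulh.

Lemma hilbert_le_shift P m e g : hprime P -> g \is e.-homog -> ~ P g ->
  (hilbert_function P m <= hilbert_function P (m + e))%N.
Proof.
move=> hP hg nPg; have := dim_add_mulh m hg hP nPg; rewrite /hilbert_function.
have : (\dim (linfun (mulh hg) @: fullv + graded_part P (m + e)) <=
        \dim {: dhomog n.+1 rat (m + e)})%N by apply: dimvS; apply: subvf.
have : (\dim (graded_part P m) <= \dim {: dhomog n.+1 rat m})%N by apply: dimvS; apply: subvf.
lia.
Qed.

(** Both P and g S lie in Q, and [dim_add_mulh] measures their sum. *)
Lemma hilbert_strict P Q m e g : hprime P -> homogeneous_ideal Q -> P `<=` Q ->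
  g \is e.-homog -> ~ P g -> Q g ->
  (hilbert_function Q (m + e) + hilbert_function P m <= hilbert_function P (m + e))%N.
Proof.
move=> hP hQ sPQ hg nPg Qg; have := dim_add_mulh m hg hP nPg; rewrite /hilbert_function.
have : (\dim (linfun (mulh hg) @: fullv + graded_part P (m + e)) <=
        \dim (graded_part Q (m + e)))%N.
  apply: dimvS; rewrite subv_add; apply/andP; split.
    apply/subvP => _ /memv_imgP[f _ ->]; apply/graded_partP => //; rewrite lfunE /=.
    exact: hidealM.
  by apply/subvP => f /graded_partP H; apply/graded_partP => //; apply: sPQ; apply: H; case: hP.
have : (\dim (graded_part P m) <= \dim {: dhomog n.+1 rat m})%N by apply: dimvS; apply: subvf.
have : (\dim (graded_part Q (m + e)) <= \dim {: dhomog n.+1 rat (m + e)})%N by apply: dimvS; apply: subvf.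
lia.
Qed.

Lemma hilbert_nondecreasing P m k : proj_prime P ->
  (hilbert_function P m <= hilbert_function P (m + k))%N.
Proof.
move=> pP; have hP := proj_prime_hprime pP; case: pP => _ _ [i nPi].
elim: k => [|k IHk]; first by rewrite addn0.
rewrite (leq_trans IHk) // addnS -addn1.
by apply: (hilbert_le_shift _ hP _ nPi); rewrite dhomogX; apply/eqP; exact: mdeg1.
Qed.

Lemma hilbert_gt0 P m : proj_prime P -> (0 < hilbert_function P m)%N.
Proof.
move=> pP; have := hilbert_nondecreasing 0 m pP; rewrite add0n; apply: leq_trans.
rewrite /hilbert_function subn_gt0 ltn_neqAle dimvS ?subvf // andbT.
apply/eqP => e; have h1 : (1 : S) \is 0.-homog by apply: dhomog1.
have [hP _ _] := pP; apply: (hideal1 hP); rewrite -[1]/(val (DHomog h1)).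
apply/graded_partP => //; have /eqP -> : graded_part P 0 == fullv by rewrite eqEdim subvf e /=.
exact: memvf.
Qed.

(** The exponent [r] plays the role of the dimension of V(P): it is [n] for the whole
    ring, and each strict inclusion of primes lowers it by one. *)
Definition growth P r :=
  exists C, forall m, (hilbert_function P m <= C * m.+1 ^ r)%N.

Lemma dim_dhomog m : \dim {: dhomog n.+1 rat m} = 'C(m + n, n).
Proof. by rewrite dimvf -[LHS]/('C(m + n, m))%N -bin_sub ?leq_addr // addKn. Qed.

Lemma bin_le_expn m k : ('C(m + k, k) <= m.+1 ^ k)%N.
Proof.
elim: k => [|k IHk]; first by rewrite bin0.
rewrite -(leq_pmul2l (ltn0Sn k)) addnS -mul_bin_diag expnS mulnA.
apply: leq_mul => //; nia.
Qed.

Lemma growth_init P : growth P n.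
Proof.
exists 1%N => m; rewrite mul1n (leq_trans (leq_subr _ _)) // dim_dhomog.
exact: bin_le_expn.
Qed.

Lemma hilbert_telescope P Q e g : hprime P -> proj_prime Q -> P `<=` Q ->
  g \is e.-homog -> ~ P g -> Q g -> forall m K,
  (K * hilbert_function Q m <= hilbert_function P (m + K * e))%N.
Proof.
move=> hP pQ sPQ hg nPg Qg m; elim=> [|K IHK] //.
have hQ : homogeneous_ideal Q by case: pQ.
have := hilbert_strict (m + K * e) hP hQ sPQ hg nPg Qg.
have := hilbert_nondecreasing m (K.+1 * e) pQ.
rewrite mulSn [(e + _)%N]addnC addnA mulSn; lia.
Qed.

Lemma proper_hom_witness P Q : homogeneous_ideal P -> homogeneous_ideal Q -> P `<` Q ->
  exists e g, [/\ g \is e.-homog, ~ P g & Q g].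
Proof.
move=> hP hQ [_ /existsNP[f /not_implyP[Qf /(pihomog_notin hP)[e nPe]]]].
by exists e, (pihomog mdeg e f); split=> //; [apply: pihomogP|apply: hQ.2].
Qed.

(** The bounds of [hilbert_strict] telescope: with [e] the degree of a form of Q
    outside P, (m+1) H_Q(m) <= H_P(m + (m+1) e), as H_Q is nondecreasing. *)
Lemma growth_proper P Q r : hprime P -> proj_prime Q -> P `<` Q ->
  growth P r.+1 -> growth Q r.
Proof.
move=> hP pQ sPQ [C HC]; have hQ : homogeneous_ideal Q by case: pQ.
have [e [g [hg nPg Qg]]] := proper_hom_witness hP.1 hQ sPQ.
exists (C * e.+1 ^ r.+1)%N => m.
rewrite -(leq_pmul2l (ltn0Sn m)).
apply: leq_trans (hilbert_telescope hP pQ sPQ.1 hg nPg Qg m m.+1) _.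
apply: leq_trans (HC _) _.
have -> : (m.+1 * (C * e.+1 ^ r.+1 * m.+1 ^ r) = C * (e.+1 * m.+1) ^ r.+1)%N.
  by rewrite expnMn [(m.+1 ^ r.+1)%N]expnS; lia.
by rewrite leq_mul2l leq_exp2r //; apply/orP; right; nia.
Qed.

(** The same telescoping makes a bounded Hilbert function unbounded, since a
    [proj_prime] has a nonzero element of S/Q in every degree. *)
Lemma growth0_maximal P Q : hprime P -> proj_prime Q -> P `<` Q -> ~ growth P 0.
Proof.
move=> hP pQ sPQ [C HC]; have hQ : homogeneous_ideal Q by case: pQ.
have [e [g [hg nPg Qg]]] := proper_hom_witness hP.1 hQ sPQ.
have := hilbert_telescope hP pQ sPQ.1 hg nPg Qg 0 C.+1.
have := hilbert_gt0 0 pQ; have := HC (0 + C.+1 * e)%N; rewrite expn0 muln1.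
move: (hilbert_function _ _) (hilbert_function _ _) => a b; nia.
Qed.

Lemma no_long_chain (c : nat -> set S) :
  (forall i, (i <= n.+1)%N -> proj_prime (c i)) ->
  (forall i, (i <= n)%N -> c i `<` c i.+1) -> False.
Proof.
move=> pc sc.
have G i : (i <= n)%N -> growth (c i) (n - i).
  elim: i => [|i IHi] lein; first by rewrite subn0; apply: growth_init.
  apply: (@growth_proper (c i)); [apply: proj_prime_hprime; apply: pc|apply: pc|apply: sc|]; try lia.
  by have := IHi (ltnW lein); rewrite -subSn // subSS.
apply: (@growth0_maximal (c n) (c n.+1)).
- by apply: proj_prime_hprime; apply: pc.
- exact: pc.
- exact: sc.
- by have := G n (leqnn n); rewrite subnn.
Qed.

End Graded.

(** * Irreducible components *)

Lemma dhomog_bigprod (R : nzRingType) n (J : Type) (r : seq J) (d : J -> nat) (F : J -> {mpoly R[n]}) :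
  (forall j, F j \is (d j).-homog) ->
  \prod_(j <- r) F j \is (\sum_(j <- r) d j).-homog.
Proof.
move=> H; elim: r => [|j r IHr]; first by rewrite !big_nil dhomog1.
by rewrite !big_cons dhomogM.
Qed.

Section Subst.
Variables (n k : nat) (l : n.+1.-tuple {mpoly rat[k]}).
Hypothesis hl : forall i, tnth l i \is 1.-homog.
Local Notation S := {mpoly rat[n.+1]}.
Implicit Types f g : S.

Lemma dhomog_comp f e : f \is e.-homog -> f \mPo l \is e.-homog.
Proof.
move=> /dhomogP hf; rewrite comp_mpolyE big_seq; apply: rpred_sum => m /hf me.
have {}me : mdeg m = e := me.
apply: rpredZ; rewrite -me mdegE; apply: dhomog_bigprod => i.
by have := dhomogMn (m i) (hl i); rewrite mul1n.
Qed.

(** Substituting linear forms preserves degrees. *)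
Lemma pihomog_comp f e : pihomog mdeg e (f \mPo l) = pihomog mdeg e f \mPo l.
Proof.
have fE := pihomog_partitionE (leqnn (mmeasure mdeg f)).
rewrite {1}fE (raddf_sum (comp_mpoly l)) (raddf_sum (pihomog mdeg e)) /=.
have hom d : (pihomog mdeg d f) \mPo l \is d.-homog.
  by apply: dhomog_comp; apply: pihomogP.
have [lt|ge] := ltnP e (mmeasure mdeg f); last first.
  rewrite big1 => [|d _]; last first.
    by rewrite (@pihomog_ne0 _ _ _ d) // neq_ltn (leq_trans (ltn_ord d) ge).
  rewrite [pihomog mdeg e f]pihomogE big_seq_cond big_pred0 ?comp_mpoly0 // => m.
  apply/negP => /andP[/mmeasure_mnm_lt mlt /eqP mE]; move: ge; rewrite leqNgt.
  by rewrite -mE mlt.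
rewrite (bigD1 (Ordinal lt)) //= pihomog_dE // big1 ?addr0 // => d dE.
by apply: (@pihomog_ne0 _ _ _ d).
Qed.

Definition subst_ideal : set S := [set f | f \mPo l = 0].

Lemma subst_ideal_homogeneous : homogeneous_ideal subst_ideal.
Proof.
split; last by move=> f m f0; rewrite /subst_ideal/= -pihomog_comp f0 pihomog0.
split; first by apply/asboolP; rewrite /subst_ideal/= comp_mpoly0.
  by apply/asboolP; rewrite /subst_ideal/= comp_mpoly1; apply/eqP/oner_neq0.
move=> a u v /asboolP u0 /asboolP v0; apply/asboolP; rewrite /subst_ideal/=.
by rewrite comp_mpolyD rmorphM /= u0 v0 mulr0 addr0.
Qed.

(** The ideal is the kernel of a graded morphism to a domain. *)
Lemma subst_ideal_proj_prime i : tnth l i != 0 -> proj_prime subst_ideal.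
Proof.
move=> li0; split; first exact: subst_ideal_homogeneous.
  move=> u v /asboolP; rewrite /subst_ideal/= rmorphM /= => /eqP.
  by rewrite mulf_eq0 => /orP[]/eqP e; apply/orP; [left|right]; apply/asboolP.
by exists i; rewrite /subst_ideal/= comp_mpolyXU -tnth_nth; apply/eqP.
Qed.
End Subst.

Section PointIdeal.
Variables (n : nat) (v : 'I_n.+1 -> rat).
Local Notation S := {mpoly rat[n.+1]}.

(** Restriction to the line spanned by [v]; the corresponding kernel is the
    homogeneous ideal of the point. *)
Definition point_subst : n.+1.-tuple {mpoly rat[1]} := [tuple v i *: 'X_ord0 | i < n.+1].

Lemma point_subst_homog i : tnth point_subst i \is 1.-homog.
Proof. by rewrite tnth_mktuple rpredZ // dhomogX; apply/eqP; apply: mdeg1. Qed.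

Lemma comp_point (f : S) e : f \is e.-homog ->
  f \mPo point_subst = f.@[v] *: 'X_ord0 ^+ e.
Proof.
move=> /dhomogP hf; rewrite comp_mpolyE mevalE scaler_suml !big_seq.
apply: eq_bigr => m /hf me; have {}me : mdeg m = e := me; rewrite -scalerA; congr (_ *: _).
rewrite (eq_bigr (fun i => v i ^+ m i *: 'X_ord0 ^+ m i)); last first.
  by move=> i _; rewrite tnth_mktuple exprZn.
by rewrite scaler_prod -me mdegE; congr (_ *: _); rewrite -expr_sum.
Qed.

Lemma comp_point0 (f : S) e : f \is e.-homog -> f \mPo point_subst = 0 <-> f.@[v] = 0.
Proof.
move=> /comp_point ->; split=> [/eqP|->]; last by rewrite scale0r.
rewrite scaler_eq0 => /orP[/eqP//|]; rewrite expf_eq0 => /andP[_] /eqP X0.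
have /eqP := congr1 (mcoeff U_(ord0)) X0.
by rewrite mcoeffXU eqxx mcoeff0 oner_eq0.
Qed.
End PointIdeal.

Section Components.
Variable n : nat.
Local Notation S := {mpoly rat[n.+1]}.
Implicit Types (I P Q : set S) (f g h G : S).

(** Otherwise each prime between I and Q would contain a strictly smaller one; this
    descent contradicts [no_long_chain]. *)
Lemma below_component I Q : proj_prime Q -> I `<=` Q ->
  exists2 P, irreducible_components I P & P `<=` Q.
Proof.
move=> pQ sIQ; apply: contrapT => nocomp.
pose good P := [/\ proj_prime P, I `<=` P & P `<=` Q].
have step P : good P -> exists P', good P' /\ P' `<` P.
  move=> [pP sIP sPQ]; apply: contrapT => H; apply: nocomp; exists P => //; split=> //.
  move=> P' pP' sIP' sP'P; apply: contrapT => ne; apply: H; exists P'; split.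
    by split=> //; apply: subset_trans sP'P sPQ.
  by rewrite properEneq; split=> //; apply/eqP.
have [down downP] : exists D : set S -> set S, forall P, good P -> good (D P) /\ D P `<` P.
  have /choice[D HD] : forall P, exists P', good P -> good P' /\ P' `<` P.
    move=> P; have [gP|ngP] := pselect (good P); last by exists P.
    by have [P' HP'] := step P gP; exists P'.
  by exists D.
have goodi i : good (iter i down Q).
  by elim: i => [|i IHi]; [split|case: (downP _ IHi)].
apply: (@no_long_chain n (fun i => iter (n.+1 - i) down Q)) => i lei.
  by case: (goodi (n.+1 - i)%N).
by rewrite subSn // subSS iterS; case: (downP _ (goodi (n - i)%N)).
Qed.

Definition principal G : set S := [set f | divides G f].

Lemma principal_homogeneous G e : G \is e.-homog -> prime_elt G ->
  homogeneous_ideal (principal G).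
Proof.
move=> hG [G0 Gu _]; split.
  split; first by apply/asboolP; exists 0; rewrite mulr0.
    apply/asboolP => -[h hE]; case/negP: Gu; by apply/unitrPr; exists h.
  move=> a u v /asboolP[h ->] /asboolP[h' ->]; apply/asboolP; exists (a * h + h').
  by rewrite mulrDr mulrCA.
move=> _ m [h ->].
rewrite (pihomog_partitionE (leqnn (mmeasure mdeg h))) mulr_sumr linear_sum /=.
apply: (big_ind (principal G)).
- by exists 0; rewrite mulr0.
- by move=> _ _ [u ->] [w ->]; exists (u + w); rewrite mulrDr.
move=> d _; have hh : G * pihomog mdeg d h \is (e + d).-homog.
  by rewrite dhomogM // pihomogP.
have [<-|ne] := eqVneq (e + d)%N m.
  by rewrite pihomog_dE //; exists (pihomog mdeg d h).
by rewrite (pihomog_ne0 ne) //; exists 0; rewrite mulr0.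
Qed.

(** The degree m + e part of (G) is G times the forms of degree m. *)
Lemma dim_graded_principal G e m : G \is e.-homog -> prime_elt G ->
  \dim (graded_part (principal G) (m + e)) = 'C(m + n, n).
Proof.
move=> hG pG; have [G0 Gu _] := pG.
rewrite -dim_dhomog -(dim_mulh hG fullv G0); congr (\dim _).
have hP := principal_homogeneous hG pG.
apply/eqP; rewrite eqEsubv; apply/andP; split; apply/subvP => f; last first.
  move=> /memv_imgP[h _ ->]; apply/graded_partP => //; rewrite lfunE /=.
  by exists (val h); rewrite mulrC.
move/graded_partP => /(_ hP)[h hE]; apply/memv_imgP.
exists (DHomog (pihomogP mdeg m h)); first exact: memvf.
rewrite lfunE; apply: val_inj => /=; rewrite mulrC.
have hf : val f \is (m + e).-homog by apply: dhomog_is_dhomog.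
have key d : pihomog mdeg (m + e) (G * pihomog mdeg d h) = if d == m then G * pihomog mdeg m h else 0.
  have hh : G * pihomog mdeg d h \is (d + e).-homog by rewrite addnC dhomogM // pihomogP.
  have [dm|ne] := eqVneq d m; first by rewrite -dm pihomog_dE.
  by rewrite (@pihomog_ne0 _ _ _ (d + e)) // eqn_add2r.
have -> : mpoly_of_dhomog f = pihomog mdeg (m + e) (val f) by rewrite pihomog_dE.
rewrite hE {1}(pihomog_partitionE (leqnn (mmeasure mdeg h))) mulr_sumr linear_sum /=.
under eq_bigr do rewrite key.
have [lt|ge] := ltnP m (mmeasure mdeg h).
  rewrite (bigD1 (Ordinal lt)) //= eqxx big1 ?addr0 // => i /negPf.
  by rewrite -val_eqE /= => ->.
rewrite big1 => [|i _]; last by rewrite ltn_eqF // (leq_trans (ltn_ord i)).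
rewrite [pihomog mdeg m h]pihomogE big_seq_cond big_pred0 ?mulr0 // => a.
apply/negP => /andP[/mmeasure_mnm_lt mlt /eqP mE]; move: ge; rewrite leqNgt.
by rewrite -mE mlt.
Qed.

End Components.

(** * The form that defines a surface *)

(** The difference has more roots than its degree allows. *)
Lemma poly_eq_large (p q : {poly rat}) N :
  (forall m : nat, (N <= m)%N -> p.[m%:R] = q.[m%:R]) -> p = q.
Proof.
move=> H; apply/eqP; rewrite -subr_eq0; apply/contraT => r0.
have := @max_poly_roots _ (p - q) (map (fun k : nat => k%:R) (iota N (size (p - q)))) r0.
rewrite size_map size_iota ltnn; apply.
  apply/allP => _ /mapP[m mN ->]; rewrite rootE hornerD hornerN H ?subrr //.
  by move: mN; rewrite mem_iota => /andP[].
by rewrite map_inj_uniq ?iota_uniq //; apply: mulrIn; rewrite oner_eq0.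
Qed.

Section Space.
Local Notation S := {mpoly rat[4]}.
Implicit Types (I P Q : set S) (f g h G : S).

Lemma bin3_rat m : 'C(m + 3, 3)%:R = (m%:R + 3) * (m%:R + 2) * (m%:R + 1) / 6 :> rat.
Proof.
have E : ('C(m + 3, 3) * 6 = (m + 3) * (m + 2) * (m + 1))%N.
  by rewrite -[6%N]/(3`!) bin_ffact !ffactnS ffactn0 muln1 !addn3 /= addn2 addn1 mulnA.
have -> : (m%:R + 3) * (m%:R + 2) * (m%:R + 1) = 'C(m + 3, 3)%:R * 6 :> rat.
  by rewrite -[_ * 6]natrM E !natrM !natrD.
by rewrite mulfK.
Qed.

(** The Hilbert polynomial is C(X + 3, 3) - C(X - e + 3, 3). *)
Lemma hilbert_poly_principal G e : G \is e.-homog -> prime_elt G -> (0 < e)%N ->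
  lead_coef (hilbert_poly (principal G)) = e%:R / 2.
Proof.
move=> hG pG e0; pose E : rat := e%:R.
pose hp : {poly rat} :=
  Poly [:: (E ^+ 3 - 6 * E ^+ 2 + 11 * E) / 6; (12 * E - 3 * E ^+ 2) / 6; E / 2].
have lead0 : E / 2 != 0 by rewrite mulf_neq0 // pnatr_eq0 -lt0n.
have hpP : exists N, forall m, (N <= m)%N ->
    hp.[m%:R] = (hilbert_function (principal G) m)%:R.
  exists e => m em; rewrite /hilbert_function natrB ?dimvS ?subvf //.
  rewrite -(subnK em) (dim_graded_principal _ hG pG) dim_dhomog !bin3_rat !natrD.
  rewrite -/E /hp horner_Poly /=; set k := (m - e)%:R; lra.
rewrite /hilbert_poly; case: xgetP => [h _ [N1 H1]|/(_ hp)//].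
have [N2 H2] := hpP.
have -> : h = hp.
  apply: (@poly_eq_large _ _ (maxn N1 N2)) => m; rewrite geq_max => /andP[m1 m2].
  by rewrite H1 // H2.
by rewrite lead_coefE (@PolyK _ 0).
Qed.

Lemma dimension_chain P r : (0 < r)%N -> dimension P = r ->
  prime_chain P r /\ forall k, prime_chain P k -> (k <= r)%N.
Proof.
rewrite /dimension; case: xgetP => [s _ [H1 H2] _ <-//|_ r_gt0 r0].
by rewrite -r0 in r_gt0.
Qed.

(** The kernels of these substitutions are the ideals generated by the first [k]
    variables, a chain of homogeneous primes of maximal length. *)
Definition coord_subst k : 4.-tuple {mpoly rat[4]} :=
  [tuple if (i < k)%N then 0 else 'X_i | i < 4].

Lemma coord_subst_homog k i : tnth (coord_subst k) i \is 1.-homog.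
Proof.
rewrite tnth_mktuple; case: ifP => _; first exact: dhomog0.
by rewrite dhomogX; apply/eqP; apply: mdeg1.
Qed.

Lemma mpolyX_neq0 (n : nat) (i : 'I_n) : 'X_i != 0 :> {mpoly rat[n]}.
Proof.
apply/eqP => /(congr1 (mcoeff U_(i)%MM)) /eqP.
by rewrite mcoeffXU eqxx mcoeff0 oner_eq0.
Qed.

Lemma coord_proj_prime k : (k < 4)%N -> proj_prime (subst_ideal (coord_subst k)).
Proof.
move=> k4; apply: (subst_ideal_proj_prime (@coord_subst_homog k) (i := Ordinal k4)).
by rewrite tnth_mktuple /= ltnn mpolyX_neq0.
Qed.

Lemma coord_chain k : (k < 4)%N ->
  subst_ideal (coord_subst k) `<` subst_ideal (coord_subst k.+1).
Proof.
move=> k4; split.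
  move=> f f0; rewrite /subst_ideal/=.
  have -> : f \mPo coord_subst k.+1 = (f \mPo coord_subst k) \mPo coord_subst k.+1.
    elim/mpolyind: f {f0} => [|c m p _ _ IHp]; first by rewrite !comp_mpoly0.
    rewrite !comp_mpolyD -IHp !comp_mpolyZ !comp_mpolyX; congr (_ *: _ + _).
    rewrite rmorph_prod /=; apply: eq_bigr => i _; rewrite rmorphXn /=; congr (_ ^+ _).
    rewrite !tnth_mktuple; case: (ltnP i k) => ik.
      by rewrite ltnS ltnW // comp_mpoly0.
    by rewrite comp_mpolyXU -tnth_nth tnth_mktuple.
  by rewrite f0 comp_mpoly0.
move=> /(_ 'X_(Ordinal k4)); rewrite /subst_ideal/= !comp_mpolyXU -!tnth_nth !tnth_mktuple /=.
by rewrite ltnSn ltnn => /(_ erefl)/eqP; rewrite (negPf (mpolyX_neq0 _)).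
Qed.

Lemma subst_ideal0 f : subst_ideal (coord_subst 0) f -> f = 0.
Proof.
by rewrite /subst_ideal/= (_ : coord_subst 0 = [tuple 'X_i | i < 4]) ?comp_mpoly_id.
Qed.

(** The zero ideal has dimension 3, so P has a nonzero form; a prime factor G of one of
    least degree is itself homogeneous, as its components lie in P.  If (G) were
    strictly contained in P, a chain of length 2 above P would extend downwards by
    (G) and 0. *)
Lemma dimension2_principal P : proj_prime P -> dimension P = 2%N ->
  exists e G, [/\ G \is e.-homog, (0 < e)%N, prime_elt G & P = principal G].
Proof.
move=> pP dP; have [[c [c1 c2]] cmax] := dimension_chain (ltn0Sn 1) dP.
have hP := proj_prime_hprime pP.
have [f0 [Pf0 f00]] : exists f, P f /\ f != 0.
  apply: contrapT => H.
  suff /cmax : prime_chain P 3 by [].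
  exists (fun k => subst_ideal (coord_subst k)); split=> i lei; last exact: coord_chain (ltnW lei).
  split; first exact: coord_proj_prime.
  move=> f Pf; have -> : f = 0 by apply: contrapT => /eqP fn; apply: H; exists f.
  by rewrite /subst_ideal/= comp_mpoly0.
pose hasdeg e := `[< exists f, [/\ P f, f != 0 & f \is e.-homog] >].
have exdeg : exists e, hasdeg e.
  have z0 : ~ subst_ideal (coord_subst 0) f0 by move/subst_ideal0/eqP; apply/negP.
  have [e He] := pihomog_notin (subst_ideal_homogeneous (@coord_subst_homog 0)) z0.
  exists e; apply/asboolP; exists (pihomog mdeg e f0); split; last exact: pihomogP.
    by apply: hP.1.2.
  by apply: contra_notN He => /eqP ->; apply: hideal0; apply: subst_ideal_homogeneous; apply: coord_subst_homog.
have [e /asboolP[f [Pf fn0 hf]] emin] := ex_minnP exdeg.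
have [u [s [uu ps fE]]] := factorial_mpoly fn0.
have [G Gs PG] : exists2 G, G \in s & P G.
  have := Pf; rewrite fE => /hP.2[Pu|].
    by case: (hideal1 hP.1); rewrite -(mulVr uu); apply: hidealM hP.1 Pu.
  elim: (s) => [|q t IHt]; first by rewrite big_nil => /(hideal1 hP.1).
  rewrite big_cons => /hP.2[Pq|/IHt[r rt Pr]]; first by exists q; rewrite ?mem_head.
  by exists r; rewrite ?in_cons ?rt ?orbT.
have pG := ps G Gs; have [G0 Gu _] := pG.
have szG : (msize G <= e.+1)%N.
  have [k fGE] : exists k, f = G * k.
    by exists (u * \prod_(q <- rem G s) q); rewrite fE (big_rem _ Gs) /= mulrCA.
  have k0 : k != 0 by apply: contraNneq fn0 => k0; rewrite fGE k0 mulr0.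
  have sf : msize f = e.+1.
    by have := dhomog_uniq fn0 hf (dhomog_msize hf) => ->; rewrite prednK // lt0n msize_poly_eq0.
  have : (0 < msize k)%N by rewrite lt0n msize_poly_eq0.
  rewrite -sf fGE msizeM //; move: (msize G) (msize k) => a b; lia.
have hG : G \is e.-homog.
  have comp0 d : d != e -> pihomog mdeg d G = 0.
    move=> de; apply: contrapT => /eqP n0.
    have le : (e <= d)%N.
      by apply: emin; apply/asboolP; exists (pihomog mdeg d G); split=> //; [apply: hP.1.2|apply: pihomogP].
    case/eqP: n0; rewrite pihomogE big_seq_cond big_pred0 // => m.
    apply/negP => /andP[/msize_mdeg_lt mlt /eqP md]; have {}md : mdeg m = d := md.
    by move: mlt le de szG; rewrite md; lia.
  rewrite (pihomog_partitionE (leqnn (mmeasure mdeg G))); apply: rpred_sum => d _.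
  by have [<-|/comp0->] := eqVneq (val d) e; [apply: pihomogP|apply: dhomog0].
have e0 : (0 < e)%N.
  rewrite lt0n; apply: contraNneq Gu => e0.
  have : (msize G <= 1)%N by rewrite (leq_trans szG) // e0.
  move/msize1_polyC => GE; rewrite GE; apply: rmorph_unit; rewrite unitfE.
  by apply: contraNneq G0 => z; rewrite GE z mpolyC0.
exists e, G; split=> //; apply/seteqP; split; last first.
  by move=> _ [h ->]; rewrite mulrC; apply: hidealM hP.1 PG.
apply: contrapT => nsub.
have sGP : principal G `<=` P by move=> _ [h ->]; rewrite mulrC; apply: hidealM hP.1 PG.
have ppG : proj_prime (principal G).
  split; first exact: principal_homogeneous hG pG.
    move=> a b /asboolP; case: pG => _ _ H /H H'; apply/orP.
    by case: H' => H'; [left|right]; apply/asboolP.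
  by case: pP => _ _ [i nPi]; exists i => /sGP.
pose z := subst_ideal (coord_subst 0).
(* 0 < (G) < c 0 < c 1 < c 2, where P is contained in c 0 *)
pose ch := [:: z; principal G; c 0%N; c 1%N; c 2%N].
have [pc0 sc0] := c1 0%N isT.
apply: (@no_long_chain 3 (fun i => nth z ch i)) => -[|[|[|[|[|i]]]]] //= _.
- exact: coord_proj_prime.
- exact: (c1 1%N isT).1.
- exact: (c1 2%N isT).1.
- split; first by move=> x /subst_ideal0 ->; exists 0; rewrite mulr0.
  by move=> /(_ G (ex_intro _ 1 (esym (mulr1 G)))) /subst_ideal0/eqP; rewrite (negPf G0).
- by split; [apply: subset_trans sGP sc0|move=> H; apply: nsub; apply: subset_trans sc0 H].
- exact: c2.
- exact: c2.
Qed.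

(** The product of the generators of the irreducible components.  Their number is
    finite because the degree, a finitely supported sum, is nonzero. *)
Lemma surface_form (X : set S) (d : nat) : (1 <= d)%N -> surface X -> degree X = d%:R ->
  exists F : S, [/\ F != 0, F \is d.-homog
    & forall v : 'I_4 -> rat, (exists i, v i != 0) -> (forall f, X f -> f.@[v] = 0) -> F.@[v] = 0].
Proof.
move=> d1 [[hX _ _] dimX] degX.
have /choice[eG eGP] : forall P, exists eG : nat * S, irreducible_components X P ->
    [/\ eG.2 \is eG.1.-homog, (0 < eG.1)%N, prime_elt eG.2 & P = principal eG.2].
  move=> P; have [cP|ncP] := pselect (irreducible_components X P); last by exists (0%N, 0).
  have [e [G H]] := dimension2_principal (let: And3 h _ _ := cP in h) (dimX P cP).
  by exists (e, G).
pose e P := (eG P).1; pose G P := (eG P).2.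
have degP P : irreducible_components X P -> irreducible_degree P = (e P)%:R.
  move=> cP; have [hG e0 pG PE] := eGP P cP.
  rewrite /irreducible_degree (dimX P cP) {1}PE (hilbert_poly_principal hG pG e0).
  by rewrite mulrC divfK.
have finC : finite_set (irreducible_components X).
  apply: contrapT => infC; have := degX; rewrite /degree fsbig_dflt; last first.
    rewrite (_ : _ `&` _ = irreducible_components X) //; apply/seteqP; split=> [P []//|P cP].
    split=> //=; rewrite degP //; apply/eqP; rewrite pnatr_eq0 -lt0n.
    by have [_ ? _ _] := eGP P cP.
  by move/esym/eqP; rewrite pnatr_eq0; lia.
pose C := fset_set (irreducible_components X).
have inC P : P \in C -> irreducible_components X P by rewrite in_fset_set // inE.
have dE : (\sum_(P <- C) e P = d)%N.
  apply/eqP; rewrite -(eqr_nat rat) -degX /degree fsbig_finite //= natr_sum.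
  by apply/eqP; apply: eq_big_seq => P /inC/degP.
exists (\prod_(P <- C) G P); split.
- rewrite prodf_seq_neq0; apply/allP => P /inC/eGP[_ _ [G0 _ _] _]; exact: G0.
- rewrite -dE big_seq [X in X.-homog]big_seq.
  elim/big_rec2: _ => [|P y F /inC/eGP[hG _ _ _] hF]; [exact: dhomog1|exact: dhomogM].
move=> v [i vi0] vX; have hs := point_subst_homog v.
have pv : proj_prime (subst_ideal (point_subst v)).
  apply: (subst_ideal_proj_prime hs (i := i)).
  by rewrite tnth_mktuple scaler_eq0 negb_or vi0 mpolyX_neq0.
have sXv : X `<=` subst_ideal (point_subst v).
  move=> f Xf; rewrite /subst_ideal/= (pihomog_partitionE (leqnn (mmeasure mdeg f))).
  rewrite (raddf_sum (comp_mpoly _)) big1 //= => k _.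
  by apply/(comp_point0 v (pihomogP mdeg k f)); apply: vX; apply: hX.2.
have [P cP sPv] := below_component pv sXv.
have [hG _ _ PE] := eGP P cP.
have GP : P (G P) by rewrite {1}PE; exists 1; rewrite mulr1.
have /(comp_point0 v hG) Gv : subst_ideal (point_subst v) (G P) by apply: sPv.
have PC : P \in C by rewrite in_fset_set // inE.
by rewrite rmorph_prod /= (big_rem P) //= Gv mul0r.
Qed.

End Space.

(** * Forms vanishing on many hyperplanes *)

Lemma uniq_size_inj (T : eqType) (U : finType) (s : seq T) (f : T -> U) :
  uniq s -> {in s &, injective f} -> (size s <= #|U|)%N.
Proof.
move=> us inj; rewrite -(size_map f).
have /card_uniqP <- : uniq (map f s) by rewrite map_inj_in_uniq.
exact: max_card.
Qed.

(** The weight [W] makes it possible to use bounds of the form K / W for the fibres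
    without dividing. *)
Lemma size_partition (T U : eqType) (s : seq T) (f : T -> U) (W K : nat) :
  (forall x, x \in s -> (W * count (fun y => f y == f x) s <= K)%N) ->
  (W * size s <= size (undup (map f s)) * K)%N.
Proof.
move=> H; have -> : size s = (\sum_(u <- undup (map f s)) count (fun y => f y == u) s)%N.
  rewrite -sum1_size (eq_big_seq (fun x => \sum_(u <- undup (map f s)) (f x == u)))%N; last first.
    move=> x xs; rewrite (bigD1_seq (f x)) ?undup_uniq ?mem_undup ?map_f //= eqxx.
    by rewrite big1 ?addn0 // => u; rewrite eq_sym => /negPf ->.
  rewrite exchange_big /=; apply: eq_bigr => u _.
  by rewrite -sum1_count [RHS]big_mkcond; apply: eq_bigr => x _; case: (f x == u).
rewrite big_distrr /= -sum1_size big_distrl /=.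
rewrite big_seq [X in (_ <= X)%N]big_seq; apply: leq_sum => u.
by rewrite mem_undup => /mapP[x xs ->]; rewrite mul1n; apply: H.
Qed.

(** The moment curve meets each hyperplane in finitely many points. *)
Lemma avoid_hyperplanes m (L : seq 'cV[rat]_m) : (forall q, q \in L -> q != 0) ->
  exists w : 'rV[rat]_m, forall q, q \in L -> (w *m q) 0 0 != 0.
Proof.
move=> L0; pose pq (q : 'cV[rat]_m) := \poly_(i < m) (if insub i is Some j then q j 0 else 0).
have pqE (q : 'cV[rat]_m) t : (pq q).[t] = ((\row_i t ^+ (val i)) *m q) 0 0.
  rewrite mxE horner_poly; apply: eq_bigr => i _; rewrite mxE mulrC.
  by rewrite insubT //= => lti; congr (_ * q _ _); apply: val_inj.
have pq0 q : q \in L -> pq q != 0.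
  move=> /L0; apply: contraNneq => e; apply/eqP/matrixP => i j; rewrite ord1 mxE.
  have := congr1 (coefp (val i)) e; rewrite /= coef_poly ltn_ord insubT //= coef0 => lti <-.
  by congr (q _ _); apply: val_inj.
have /poly_nonroot[t] : \prod_(q <- L) pq q != 0.
  by rewrite prodf_seq_neq0; apply/allP => q /pq0.
rewrite horner_prod prodf_seq_neq0 => /allP H; exists (\row_i t ^+ (val i)) => q qL.
by rewrite -pqE; apply: H.
Qed.

(** This is all that is needed of a polynomial function of degree [d]; it is stable
    under restriction to linear subspaces in any parametrization. *)
Definition line_degree_le m (d : nat) (f : 'rV[rat]_m -> rat) :=
  forall z w, exists2 p : {poly rat}, (size p <= d.+1)%N & forall t, p.[t] = f (z + t *: w).

(** A generic line through [z] meets the hyperplanes in distinct points, which are roots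
    of a nonzero polynomial of degree at most [d].  The lemma bounds in the same way
    the planes in a zero set, the lines in a plane section, and the points on a line. *)
Lemma few_zero_hyperplanes m d (f : 'rV[rat]_m -> rat) (L : seq 'cV[rat]_m) z :
  line_degree_le d f -> f z != 0 -> uniq L ->
  (forall l u, l \in L -> u *m l = 0 -> f u = 0) ->
  (forall l l', l \in L -> l' \in L -> l != l' -> forall c, l' <> c *: l) ->
  (size L <= d)%N.
Proof.
move=> fd fz uL Lf ind; pose ev (u : 'rV[rat]_m) (l : 'cV[rat]_m) := (u *m l) 0 0.
have ev0 u l : ev u l = 0 -> u *m l = 0.
  by move=> e; apply/matrixP => i j; rewrite !ord1 [RHS]mxE.
have evB u a b l l' : ev u (a *: l - b *: l') = a * ev u l - b * ev u l'.
  by rewrite /ev mulmxBr -!scalemxAr; move: (u *m l) (u *m l') => x y; rewrite !mxE.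
have evD u v a l : ev (u + a *: v) l = ev u l + a * ev v l.
  by rewrite /ev mulmxDl -scalemxAl; move: (u *m l) (v *m l) => x y; rewrite !mxE.
have lz l : l \in L -> ev z l != 0.
  by move=> lL; apply: contra_neq fz => /ev0; apply: Lf.
pose D := [seq ev z p.1 *: p.2 - ev z p.2 *: p.1 | p <- allpairs pair L L & p.1 != p.2].
have [w wP] : exists w : 'rV[rat]_m, forall q, q \in L ++ D -> (w *m q) 0 0 != 0.
  apply: avoid_hyperplanes => q; rewrite mem_cat => /orP[qL|].
    by apply: contraNneq (lz q qL) => ->; rewrite /ev mulmx0 mxE.
  move=> /mapP[[l l']]; rewrite mem_filter /= => /andP[ne /allpairsP[[a b] /= [aL bL [la lb]]]] ->.
  subst a b; rewrite subr_eq0; apply/eqP => e.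
  apply: (ind l l' aL bL ne (ev z l' / ev z l)).
  by apply: (scalerI (lz l aL)); rewrite e scalerA mulrC divfK ?lz.
pose t l := - ev z l / ev w l.
have wl l : l \in L -> ev w l != 0 by move=> lL; apply: wP; rewrite mem_cat lL.
have tinj : {in L &, injective t}.
  move=> l l' lL l'L tE; apply: contrapT => /eqP ne.
  have := wP (ev z l *: l' - ev z l' *: l); rewrite mem_cat; case/(_ _)/negP.
    apply/orP; right; apply/mapP; exists (l, l') => //; rewrite mem_filter /= ne /=.
    by apply/allpairsP; exists (l, l').
  rewrite -/(ev w _) evB subr_eq0; apply/eqP.
  have := congr1 (fun c => - c * ev w l * ev w l') tE; rewrite /t !mulNr !opprK.
  by rewrite divfK ?wl // mulrAC divfK ?wl // mulrC.
have [p sp pE] := fd z w.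
have p0 : p != 0.
  by apply: contraNneq fz => p0; have := pE 0; rewrite p0 horner0 scale0r addr0 => <-.
have := @max_poly_roots _ p (map t L) p0; rewrite size_map map_inj_in_uniq // => H.
rewrite -ltnS (leq_trans _ sp) //; apply: H => //.
apply/allP => _ /mapP[l lL ->]; rewrite rootE pE; apply/eqP; apply: (Lf l) => //.
by apply: ev0; rewrite evD /t divfK ?wl // subrr.
Qed.

Section Forms.
Variables (d k : nat) (F : {mpoly rat[k]}).
Hypothesis hF : F \is d.-homog.
Definition row_eval (v : 'rV[rat]_k) := F.@[fun i => v 0 i].

Lemma row_eval_scale c v : row_eval (c *: v) = c ^+ d * row_eval v.
Proof.
rewrite /row_eval !mevalE big_distrr /= !big_seq; apply: eq_bigr => m /(elimT (dhomogP _ _ _) hF) me.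
have {}me : mdeg m = d := me.
rewrite [RHS]mulrCA; congr (_ * _); rewrite (eq_bigr (fun i => c ^+ m i * v 0 i ^+ m i)).
  by rewrite big_split /= -expr_sum -me mdegE.
by move=> i _; rewrite mxE exprMn.
Qed.

Lemma size_polyM_le (p q : {poly rat}) a b :
  (size p <= a.+1)%N -> (size q <= b.+1)%N -> (size (p * q)%R <= (a + b).+1)%N.
Proof. by move=> sp sq; apply: leq_trans (size_polyMleq p q) _; lia. Qed.

Lemma row_eval_line_degree : line_degree_le d row_eval.
Proof.
move=> z w; pose h i : {poly rat} := (z 0 i)%:P + (w 0 i) *: 'X.
exists (mmap polyC h F) => [|t].
  rewrite /mmap big_seq; apply: (big_ind (fun p : {poly rat} => (size p <= d.+1)%N)).
  - by rewrite size_poly0.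
  - by move=> p q sp sq; rewrite (leq_trans (size_polyD _ _)) // geq_max sp.
  move=> m /(elimT (dhomogP _ _ _) hF) me; have {}me : mdeg m = d := me.
  have : (size (mmap1 h m) <= d.+1)%N.
    rewrite -me mdegE /mmap1.
    apply: (big_ind2 (fun (p : {poly rat}) (e : nat) => (size p <= e.+1)%N)).
    - by rewrite size_poly1.
    - by move=> p a q b; apply: size_polyM_le.
    move=> i _; have sh : (size (h i) <= 2)%N.
      rewrite /h (leq_trans (size_polyD _ _)) // geq_max (leq_trans (size_polyC_leq1 _)) //=.
      by rewrite (leq_trans (size_scale_leq _ _)) // size_polyX.
    elim: (m i) => [|j IHj]; first by rewrite expr0 size_poly1.
    by rewrite exprS -[j.+1]add1n; apply: size_polyM_le.
  move=> sm; rewrite -[d]add0n; apply: size_polyM_le => //.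
  exact: size_polyC_leq1.
rewrite /row_eval mevalE /mmap horner_sum; apply: eq_bigr => m _.
rewrite hornerM hornerC; congr (_ * _); rewrite /mmap1 horner_prod.
by apply: eq_bigr => i _; rewrite horner_exp /h hornerD hornerC hornerZ hornerX !mxE mulrC.
Qed.

Lemma row_eval_comp_line_degree m (U : 'M[rat]_(m, k)) : line_degree_le d (fun u => row_eval (u *m U)).
Proof.
move=> z w; have [p sp pE] := row_eval_line_degree (z *m U) (w *m U).
by exists p => // t; rewrite pE mulmxDl scalemxAl.
Qed.
End Forms.

(** * Short vectors orthogonal to an integer point *)

Lemma pigeonhole (T : finType) (f : T -> int) (W : nat) :
  (forall t, (`|(f t)%R| <= W)%N) -> (2 * W + 1 < #|T|)%N ->
  exists t1 t2, t1 != t2 /\ f t1 = f t2.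
Proof.
move=> fW big; apply: contrapT => H.
pose g t : 'I_(2 * W).+1 := inord `|(f t + W)%R|.
have : (#|T| <= #|{: 'I_(2 * W).+1}|)%N; last by rewrite card_ord; lia.
apply: (leq_card g) => t1 t2 gE; apply: contrapT => /eqP ne; apply: H; exists t1, t2; split=> //.
have := congr1 val gE; rewrite /= !inordK; have := fW t1; have := fW t2; lia.
Qed.


Local Notation Z4 := 'rV[int]_4.
Local Notation toQ := (map_mx (intr : int -> rat)).

Section ShortVectors.
Implicit Types (a b c x y : 'rV[int]_4) (i j : 'I_4).

Definition dot a x : int := \sum_i a 0 i * x 0 i.
Definition norm_le (K : nat) a := forall i, (`|(a 0 i)%R| <= K)%N.

Lemma dotD1 i a x : dot a x = a 0 i * x 0 i + \sum_(j < 3) a 0 (lift i j) * x 0 (lift i j).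
Proof. by rewrite /dot (bigD1_ord i). Qed.

Lemma dotD a b x : dot (a + b) x = dot a x + dot b x.
Proof. by rewrite /dot -big_split; apply: eq_bigr => i _; rewrite mxE mulrDl. Qed.

Lemma dotN a x : dot (- a) x = - dot a x.
Proof. by rewrite /dot -sumrN; apply: eq_bigr => i _; rewrite mxE mulNr. Qed.

Lemma dotB a b x : dot (a - b) x = dot a x - dot b x.
Proof. by rewrite dotD dotN. Qed.

Lemma dotZ (r : int) a x : dot (r *: a) x = r * dot a x.
Proof. by rewrite /dot big_distrr; apply: eq_bigr => i _; rewrite mxE -mulrA. Qed.

Lemma absz_sum (J : finType) (F : J -> int) (B : nat) :
  (forall t, (`|(F t)%R| <= B)%N) -> (`|(\sum_t F t)%R| <= #|J| * B)%N.
Proof.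
move=> H; rewrite -lez_nat abszE (le_trans (ler_norm_sum _ _ _)) //.
rewrite (le_trans (ler_sum _ (_ : forall t, _ -> _ <= B%:Z))) //.
  by move=> j _; rewrite -abszE lez_nat.
by rewrite sumr_const -mulr_natl natz PoszM.
Qed.

(** Minimality of the sup norm [A] is expressed by a large coordinate of every competitor,
    the form in which it is used; as [a] is one of them, its norm is exactly [A]. *)
Definition shortest A a x :=
  [/\ a != 0, dot a x = 0, norm_le A a &
    forall c, c != 0 -> dot c x = 0 -> exists i, (A <= `|(c 0 i)%R|)%N].

(** The (2M+1)^4 vectors with coordinates in [0, 2M] take fewer values at [x], so two
    of them have the same value. *)
Lemma siegel x N M : norm_le N x -> (0 < M)%N -> (N <= M ^ 3)%N ->
  exists c, [/\ c != 0, dot c x = 0 & norm_le (2 * M) c].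
Proof.
move=> xN M0 NM; set K := (2 * M)%N.
pose v (t : {ffun 'I_4 -> 'I_K.+1}) : Z4 := \row_i (t i : nat)%:Z.
have [||t1 [t2 [ne e]]] := @pigeonhole _ (fun t => dot (v t) x) (4 * (K * N)).
- move=> t; rewrite -[4%N]card_ord; apply: absz_sum => i; rewrite abszM mxE absz_nat.
  by apply: leq_mul => //; rewrite -ltnS.
- rewrite card_ffun !card_ord /K.
  have : (N * (2 * M) <= M ^ 3 * (2 * M))%N by rewrite leq_mul2r NM orbT.
  have -> : ((2 * M).+1 ^ 4 = 16 * (M ^ 3 * M) + 32 * M ^ 3 + 24 * M ^ 2 + 8 * M + 1)%N.
    by rewrite -[RHS]/_ !expnS !expn0; lia.
  lia.
exists (v t1 - v t2); split.
- apply: contra ne => /eqP/matrixP vE; apply/eqP/ffunP => i; apply: val_inj.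
  by have := vE 0 i; rewrite !mxE /=; lia.
- by rewrite dotB e subrr.
- by move=> i; rewrite !mxE; move: (t1 i) (t2 i) => [p hp] [q hq] /=; lia.
Qed.

Lemma exists_shortest x N M : norm_le N x -> (0 < M)%N -> (N <= M ^ 3)%N ->
  exists A a, (A <= 2 * M)%N /\ shortest A a x.
Proof.
move=> xN M0 NM; pose P k := `[< exists c, [/\ c != 0, dot c x = 0 & norm_le k c] >].
have PM : P (2 * M)%N by apply/asboolP; apply: siegel xN M0 NM.
have [A /asboolP[a [a0 ax aA]] Amin] := ex_minnP (ex_intro P _ PM).
exists A, a; split; first exact: Amin.
split=> // c c0 cx; apply: contrapT => H.
have A0 : (0 < A)%N.
  rewrite lt0n; apply: contraNneq a0 => A0; apply/eqP/matrixP => i j.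
  by rewrite ord1 mxE; have := aA j; rewrite A0 leqn0 absz_eq0 => /eqP.
have /Amin : P A.-1; last by lia.
apply/asboolP; exists c; split=> // i; rewrite leqNgt; apply/negP => lt.
by apply: H; exists i; lia.
Qed.

Lemma shortest_attained A a x : shortest A a x -> exists i, `|(a 0 i)%R|%N = A.
Proof.
move=> [a0 ax aA /(_ a a0 ax)[i Ai]]; exists i.
by apply/eqP; rewrite eqn_leq aA Ai.
Qed.

Lemma shortest_gt0 A a x : shortest A a x -> (0 < A)%N.
Proof.
move=> [a0 ax aA _]; rewrite lt0n; apply: contraNneq a0 => A0; apply/eqP/matrixP => i j.
by rewrite ord1 mxE; have := aA j; rewrite A0 leqn0 absz_eq0 => /eqP.
Qed.

Definition minor (R : pzRingType) (x y : 'rV[R]_4) i j : R := x 0 i * y 0 j - y 0 i * x 0 j.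

(** Pigeonhole again, in the box where coordinate [i] runs over [0, A) and the three
    others over [0, K].  The difference of two vectors with the same value at [x] has
    a coordinate [i] smaller than [A]; were it proportional to [a], it would be
    shorter than [a]. *)
Lemma exists_second A a x i N K : shortest A a x -> `|(a 0 i)%R|%N = A -> norm_le N x ->
  (A <= K)%N -> (0 < N)%N -> (8 * N <= A * K ^ 2)%N ->
  exists b, [/\ dot b x = 0, (`|(b 0 i)%R| < A)%N, norm_le K b &
    exists j, minor a b i j != 0].
Proof.
move=> sA ai xN AK N0 NK; have A0 := shortest_gt0 sA.
have [a0 ax aA amin] := sA.
pose v (t : 'I_A * {ffun 'I_3 -> 'I_K.+1}) : Z4 :=
  \row_m if unlift i m is Some j then (t.2 j : nat)%:Z else (t.1 : nat)%:Z.
have vi t : v t 0 i = (t.1 : nat)%:Z by rewrite mxE unlift_none.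
have vl t (j : 'I_3) : v t 0 (lift i j) = (t.2 j : nat)%:Z by rewrite mxE liftK.
have vK t m : (`|(v t 0 m)%R| <= K)%N.
  case: (unliftP i m) => [j|] ->; rewrite ?vl ?vi /= -ltnS //.
  by rewrite (leq_trans (ltn_ord _)) // (leq_trans AK).
have [||t1 [t2 [ne e]]] := @pigeonhole _ (fun t => dot (v t) x) (4 * (K * N)).
- move=> t; rewrite -[4%N]card_ord; apply: absz_sum => m; rewrite abszM.
  exact: leq_mul.
- rewrite card_prod card_ffun !card_ord.
  have : (8 * N * K <= A * K ^ 2 * K)%N by rewrite leq_mul2r NK orbT.
  have K1 : (0 < K)%N by lia.
  have : (1 <= A * K ^ 2)%N by rewrite (leq_trans _ NK) //; lia.
  have -> : (A * K.+1 ^ 3 = A * K ^ 2 * K + 3 * (A * K ^ 2) + 3 * (A * K) + A)%N.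
    by rewrite !expnS !expn0; lia.
  lia.
have b0 : v t1 - v t2 != 0.
  apply: contra ne => /eqP/matrixP vE; apply/eqP; apply: injective_projections.
    by apply: val_inj; have := vE 0 i; rewrite mxE [X in _ + X]mxE !vi mxE /=; lia.
  apply/ffunP => j; apply: val_inj; have := vE 0 (lift i j).
  by rewrite mxE [X in _ + X]mxE !vl mxE /=; lia.
have bi : (`|((v t1 - v t2) 0 i)%R| < A)%N.
  by rewrite mxE [X in _ + X]mxE !vi; move: t1.1 t2.1 => [p hp] [q hq] /=; lia.
have bx : dot (v t1 - v t2) x = 0 by rewrite dotB e subrr.
exists (v t1 - v t2); split=> // [m|].
  case: (unliftP i m) => [j|] ->; last by rewrite (leq_trans (ltnW bi)).
  by rewrite mxE [X in _ + X]mxE !vl; move: (t1.2 j) (t2.2 j) => [p hp] [q hq] /=; lia.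
apply: contrapT => H; have [m Am] := amin _ b0 bx.
have : minor a (v t1 - v t2) i m = 0 by apply: contrapT => /eqP ne0; apply: H; exists m.
move: (v t1 - v t2) => w in bi Am * => /eqP.
rewrite /minor subr_eq0 => /eqP /(congr1 absz); rewrite !abszM ai => E.
have H1 : (A * A <= A * `|(w 0 m)%R|)%N by rewrite leq_mul2l Am orbT.
rewrite E in H1; have := leq_trans H1 (leq_mul (leqnn _) (aA m)).
by rewrite leq_pmul2r // leqNgt bi.
Qed.
End ShortVectors.

(** * Minors of two integer points *)

(** The lattice spanned by (u1, u2) and (v1, v2) has index |det| in Z^2.  With g the gcd
    of the first coordinates, it contains (g, h) for some h and (0, e) with
    g e = det, so reduction modulo these two vectors gives the classes. *)
Lemma lattice_classes (u1 u2 v1 v2 : int) : u1 * v2 - v1 * u2 != 0 ->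
  exists cl : int -> int -> nat,
    (forall p q, (cl p q < `|(u1 * v2 - v1 * u2)%R|)%N) /\
    forall p q p' q', cl p q = cl p' q' ->
      exists s t, p - p' = s * u1 + t * v1 /\ q - q' = s * u2 + t * v2.
Proof.
set D := _ - _ => D0; pose g := gcdz u1 v1.
have [al [be bez]] := Bezoutz u1 v1; rewrite -/g in bez.
have /dvdzP[u1' u1E] : (g %| u1)%Z by apply: dvdz_gcdl.
have /dvdzP[v1' v1E] : (g %| v1)%Z by apply: dvdz_gcdr.
pose e := u1' * v2 - v1' * u2; pose h := al * u2 + be * v2.
have DE : D = g * e by rewrite /D /e u1E v1E; lra.
have g0 : g != 0 by apply: contraNneq D0 => g0; rewrite DE g0 mul0r.
have e0 : e != 0 by apply: contraNneq D0 => e0; rewrite DE e0 mulr0.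
pose r1 p := `|(p %% g)%Z|%N; pose r2 p q := `|((q - (p %/ g)%Z * h) %% e)%Z|%N.
have r1lt p : (r1 p < `|g|)%N.
  by rewrite /r1 -ltz_nat !abszE ger0_norm ?modz_ge0 // ltz_mod.
have r2lt p q : (r2 p q < `|e|)%N.
  by rewrite /r2 -ltz_nat !abszE ger0_norm ?modz_ge0 // ltz_mod.
exists (fun p q => r1 p * `|e| + r2 p q)%N; split=> [p q|p q p' q' clE].
  rewrite DE abszM.
  have : (r1 p * `|e| + `|e| <= `|g| * `|e|)%N by rewrite -mulSnr leq_mul2r r1lt orbT.
  have := r2lt p q; lia.
have e1 : (0 < `|e|)%N by rewrite absz_gt0.
have E1 : r1 p = r1 p'.
  have := congr1 (fun k => k %/ `|e|)%N clE.
  by rewrite !divnMDl // !divn_small ?addn0.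
have E2 : r2 p q = r2 p' q'.
  have := congr1 (fun k => k %% `|e|)%N clE.
  by rewrite !modnMDl !modn_small.
have M1 : (p %% g)%Z = (p' %% g)%Z.
  by have := congr1 Posz E1; rewrite /r1 !abszE !ger0_norm ?modz_ge0.
have M2 : ((q - (p %/ g)%Z * h) %% e)%Z = ((q' - (p' %/ g)%Z * h) %% e)%Z.
  by have := congr1 Posz E2; rewrite /r2 !abszE !ger0_norm ?modz_ge0.
have /dvdzP[m mE] : (e %| (q - (p %/ g)%Z * h) - (q' - (p' %/ g)%Z * h))%Z.
  by rewrite -eqz_mod_dvd; apply/eqP.
set k := (p %/ g)%Z - (p' %/ g)%Z.
have kE : p - p' = k * g.
  rewrite [in LHS](divz_eq p g) [in LHS](divz_eq p' g) M1 /k mulrBl; lra.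
have qE : q - q' = k * h + m * e by rewrite -mE /k mulrBl; lra.
exists (k * al - m * v1'), (k * be + m * u1'); split.
  rewrite kE -bez mulrDr !mulrDl mulNr.
  have -> : m * u1' * v1 = m * v1' * u1 by rewrite u1E v1E; lra.
  lra.
by rewrite qE /h /e; lra.
Qed.

Lemma nat_sqrt n : exists K, (K ^ 2 <= n < K.+1 ^ 2)%N.
Proof.
have ex0 : exists K, (K ^ 2 <= n)%N by exists 0%N.
have bnd K : (K ^ 2 <= n)%N -> (K <= n)%N by move=> H; nia.
have [K Kn Kmax] := ex_maxnP ex0 bnd; exists K; rewrite Kn ltnNge.
by apply/negP => /Kmax; rewrite ltnn.
Qed.

Lemma cramer_fst (p q r u v w : int) : p * (q * v - u * r) =
  (p * q + w * r) * v - (p * u + w * v) * r.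
Proof. lra. Qed.

Lemma cramer_snd (p q r u v w : int) : - w * (q * v - u * r) =
  (p * q + w * r) * u - (p * u + w * v) * q.
Proof. lra. Qed.

(** Let P be the maximal minor.  The two coordinates outside [i] and [j] run over
    [0, K] with K^2 <= P < (K+1)^2; two choices agree modulo the lattice spanned by the
    columns [i] and [j], and their difference extends to an integer vector orthogonal
    to [x] and [y].  Cramer's rule and the maximality of P bound its coordinates by 2K. *)
Lemma minor_lower_bound A x y i j :
  (forall c, c != 0 -> dot c x = 0 -> exists m, (A <= `|(c 0 m)%R|)%N) ->
  minor x y i j != 0 -> (forall k l, (`|minor x y k l| <= `|minor x y i j|)%N) ->
  (A ^ 2 <= 4 * `|minor x y i j|)%N.
Proof.
move=> xmin D0 Dmax; set D := minor x y i j.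
have ij : i != j by apply: contraNneq D0 => ->; rewrite /minor mulrC subrr.
case: (unliftP i j) ij => [j'|] jE; last by rewrite jE eqxx.
move=> _; pose o (t : 'I_2) := lift i (lift j' t).
have sum4 (f : 'I_4 -> int) : \sum_k f k = f i + (f j + \sum_t f (o t)).
  by rewrite (bigD1_ord i) //= (bigD1_ord j') //= jE.
have D0' : x 0 i * y 0 j - x 0 j * y 0 i != 0 by rewrite (mulrC (x 0 j)).
have DE' : x 0 i * y 0 j - x 0 j * y 0 i = D by rewrite (mulrC (x 0 j)).
have [cl [cllt clP]] := lattice_classes D0'; rewrite DE' in cllt.
have [K /andP[K1 K2]] := nat_sqrt `|D|.
pose S (z : Z4) (t : {ffun 'I_2 -> 'I_K.+1}) : int := \sum_k (t k : nat)%:Z * z 0 (o k).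
have Dgt : (0 < `|D|)%N by rewrite absz_gt0.
pose clt t : 'I_`|D| := Ordinal (cllt (S x t) (S y t)).
have [t1 [t2 [ne clE]]] : exists t1 t2, t1 != t2 /\ clt t1 = clt t2.
  apply: contrapT => H; have : (#|{ffun 'I_2 -> 'I_K.+1}| <= #|'I_`|D| |)%N.
    apply: (leq_card clt) => t1 t2 tE; apply: contrapT => /eqP ne; apply: H.
    by exists t1, t2.
  by rewrite card_ffun !card_ord leqNgt K2.
have [s [t [sE tE]]] := clP _ _ _ _ (congr1 val clE).
pose w k : int := (t1 k : nat)%:Z - (t2 k : nat)%:Z.
have wK k : (`|w k| <= K)%N by rewrite /w; move: (t1 k) (t2 k) => [p hp] [q hq] /=; lia.
have SE z : S z t1 - S z t2 = \sum_k w k * z 0 (o k).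
  by rewrite /S -sumrB; apply: eq_bigr => k _; rewrite mulrBl.
pose c : Z4 := \row_m if unlift i m is Some m' then
   (if unlift j' m' is Some k then w k else - t) else - s.
have ci : c 0 i = - s by rewrite mxE unlift_none.
have cj : c 0 j = - t by rewrite mxE jE liftK unlift_none.
have co k : c 0 (o k) = w k by rewrite mxE /o liftK liftK.
have dotc z : dot c z = - s * z 0 i + (- t * z 0 j + \sum_k w k * z 0 (o k)).
  by rewrite /dot sum4 ci cj; congr (_ + (_ + _)); apply: eq_bigr => k _; rewrite co.
have cx : dot c x = 0 by rewrite dotc -SE sE !mulNr addrA -opprD addNr.
have cy : dot c y = 0 by rewrite dotc -SE tE !mulNr addrA -opprD addNr.
have c0 : c != 0.
  apply: contra ne => /eqP cE; apply/eqP/ffunP => k; apply: val_inj => /=.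
  have := congr1 (fun c : Z4 => c 0 (o k)) cE; rewrite co mxE /w; move: (t1 k) (t2 k) => [p hp] [q hq] /=; lia.
have bound (u : int) (m : 'I_4) :
    u * D = \sum_k w k * minor x y (o k) m -> (`|u| <= 2 * K)%N.
  move=> uE; rewrite -(leq_pmul2r Dgt) -abszM uE -mulnA.
  have := @absz_sum 'I_2 (fun k => w k * minor x y (o k) m) (K * `|D|).
  by rewrite card_ord; apply=> k; rewrite abszM; apply: leq_mul.
have minS m : \sum_k w k * minor x y (o k) m =
    (\sum_k w k * x 0 (o k)) * y 0 m - (\sum_k w k * y 0 (o k)) * x 0 m.
  by rewrite !big_distrl -sumrB /=; apply: eq_bigr => k _; rewrite /minor mulrBr !mulrA.
have sK : (`|s| <= 2 * K)%N.
  by apply: (bound _ j); rewrite minS -!SE sE tE /D /minor; apply: cramer_fst.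
have tK : (`|t| <= 2 * K)%N.
  by rewrite -abszN; apply: (bound _ i); rewrite minS -!SE sE tE /D /minor; apply: cramer_snd.
have [m Am] := xmin c c0 cx.
have : (A <= 2 * K)%N.
  apply: leq_trans Am _; case: (unliftP i m) => [m'|] ->; last by rewrite ci abszN.
  case: (unliftP j' m') => [k|] ->; last by rewrite -jE cj abszN.
  by rewrite co (leq_trans (wK k)) // leq_pmull.
move=> AK; apply: leq_trans (_ : (2 * K) ^ 2 <= _)%N; first by rewrite leq_exp2r.
by rewrite expnMn leq_mul2l K1 orbT.
Qed.

Lemma slope_identity (ux uy rx ry n : rat) :
  (ux * (ry * uy) - uy * (rx * ux)) * n = ((ry + 1) * n - (rx + 1) * n) * ux * uy.
Proof. lra. Qed.

(** The slopes w/u lie in [-1, 1], and two of them differ by at least D / N^2. *)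
Lemma separated_half (T : eqType) (s : seq T) (u w : T -> int) (N D : nat) :
  uniq s -> (0 < D)%N ->
  (forall x, x \in s -> (`|(w x)%R| <= `|(u x)%R|)%N /\ (`|(u x)%R| <= N)%N) ->
  (forall x y, x \in s -> y \in s -> x != y -> (D <= `|(u x * w y - u y * w x)%R|)%N) ->
  (D * size s <= 2 * N ^ 2 + D)%N.
Proof.
move=> us D0 wu sep.
have [|s1] := leqP (size s) 1%N; first by nia.
have u0 x : x \in s -> u x != 0.
  move=> xs; apply/eqP => ux.
  have wx : w x = 0 by have [] := wu x xs; rewrite ux; lia.
  have [y ys yx] : exists2 y, y \in s & y != x.
    apply: contrapT => H; have : (size s <= size [:: x])%N; last by rewrite leqNgt s1.
    apply: uniq_leq_size => // y ys; rewrite inE; apply: contrapT => /negP yx.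
    by apply: H; exists y.
  have := sep x y xs ys; rewrite eq_sym yx ux wx mul0r mulr0 subrr absz0; lia.
pose q x : rat := ((w x)%:~R / (u x)%:~R + 1) * (N ^ 2)%:R / D%:R.
have Dq : 0 < D%:R :> rat by rewrite ltr0n.
have q0 x : x \in s -> 0 <= q x <= (2 * N ^ 2)%:R / D%:R.
  move=> xs; have [wx _] := wu x xs.
  have r1 : `|(w x)%:~R / (u x)%:~R : rat| <= 1.
    rewrite normrM normfV ler_pdivrMr ?normr_gt0 ?intr_eq0 ?u0 // mul1r.
    by rewrite -!intr_norm ler_int; lia.
  move: r1; rewrite ler_norml => /andP[r1 r2]; rewrite /q; apply/andP; split.
    by rewrite divr_ge0 ?ler0n // mulr_ge0 ?ler0n //; lra.
  rewrite ler_pM2r ?invr_gt0 // natrM ler_wpM2r ?ler0n //; lra.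
pose V := (2 * N ^ 2 %/ D)%N.
have fl x : x \in s -> exists2 k, (k <= V)%N & k%:R <= q x < k.+1%:R.
  move=> xs; have /andP[qx0 qxV] := q0 x xs.
  have := truncn_itv qx0; set k := Num.Def.trunc _ => kI; exists k => //.
  rewrite leq_divRL // -(ler_nat rat) natrM -ler_pdivlMr //.
  by apply: le_trans qxV; case/andP: kI.
have /choice[k kP] : forall x, exists k : nat, x \in s -> (k <= V)%N /\ k%:R <= q x < k.+1%:R.
  move=> x; have [xs|] := boolP (x \in s); last by exists 0%N.
  by have [k] := fl x xs; exists k.
have : (size s <= #|'I_V.+1|)%N.
  apply: (@uniq_size_inj _ _ s (fun x => inord (k x) : 'I_V.+1)) => // x y xs ys /(congr1 val).
  have [kx /andP[qx1 qx2]] := kP x xs; have [ky /andP[qy1 qy2]] := kP y ys.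
  rewrite /= !inordK // => kE; apply: contrapT => /eqP ne.
  have := sep x y xs ys ne.
  have dq : `|q y - q x| < 1.
    rewrite kE in qx1 qx2; rewrite -[(k y).+1]addn1 natrD in qx2 qy2.
    by rewrite ltr_norml; lra.
  have qE : (u x * w y - u y * w x)%:~R * (N ^ 2)%:R = (q y - q x) * D%:R * (u x)%:~R * (u y)%:~R :> rat.
    have ux : (u x)%:~R != 0 :> rat by rewrite intr_eq0 u0.
    have uy : (u y)%:~R != 0 :> rat by rewrite intr_eq0 u0.
    have qD t : q t * D%:R = ((w t)%:~R / (u t)%:~R + 1) * (N ^ 2)%:R.
      by rewrite /q divfK // lt0r_neq0.
    rewrite mulrBl !qD rmorphB !rmorphM /=.
    rewrite -[(w x)%:~R in LHS](divfK ux) -[(w y)%:~R in LHS](divfK uy).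
    exact: slope_identity.
  apply/negP; rewrite -ltnNge -ltz_nat abszE -(ltr_int rat) intr_norm.
  have Nx : (0 < N)%N by have [_] := wu x xs; apply: leq_trans; rewrite absz_gt0 u0.
  have N0 : 0 < (N ^ 2)%:R :> rat by rewrite ltr0n expn_gt0 Nx.
  rewrite -(ltr_pM2r N0) -[X in `|_| * X](gtr0_norm N0) -normrM qE !normrM.
  rewrite (gtr0_norm Dq) -mulrA -mulrA [X in _ < X](_ : _ = 1 * (D%:R * (N ^ 2)%:R)) ?mul1r //.
  apply: (@le_lt_trans _ _ (`|q y - q x| * (D%:R * (N ^ 2)%:R))).
    rewrite ler_wpM2l // ler_wpM2l ?ler0n // natrX expr2.
    by rewrite ler_pM // -intr_norm -abszE ler_nat; [case: (wu x xs)|case: (wu y ys)].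
  by rewrite -[X in _ < X]mul1r ltr_pM2r // mulr_gt0.
rewrite card_ord => /leq_trans H; rewrite (leq_trans (_ : _ <= D * V.+1)%N) ?leq_mul2l ?H ?orbT //.
by rewrite mulnS addnC leq_add2r mulnC leq_trunc_div.
Qed.

(** * Counting integer vectors *)

Section Boxes.
Implicit Types (a b c x y : 'rV[int]_4) (i j : 'I_4).

Lemma separated (T : eqType) (s : seq T) (u w : T -> int) (N D : nat) :
  uniq s -> (0 < D)%N ->
  (forall t, t \in s -> (`|(w t)%R| <= N)%N /\ (`|(u t)%R| <= N)%N) ->
  (forall t t', t \in s -> t' \in s -> t != t' ->
     (D <= `|(u t * w t' - u t' * w t)%R|)%N) ->
  (D * size s <= 4 * N ^ 2 + 2 * D)%N.
Proof.
move=> us D0 wu sep; pose p t := (`|(w t)%R| <= `|(u t)%R|)%N.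
have -> : size s = (size (filter p s) + size (filter (predC p) s))%N.
  by rewrite !size_filter count_predC.
have H1 : (D * size (filter p s) <= 2 * N ^ 2 + D)%N.
  apply: (@separated_half _ _ u w) => //; first exact: filter_uniq.
    by move=> t; rewrite mem_filter => /andP[pt /wu[]].
  by move=> t t'; rewrite !mem_filter => /andP[_ ts] /andP[_ ts']; apply: sep.
have H2 : (D * size (filter (predC p) s) <= 2 * N ^ 2 + D)%N.
  apply: (@separated_half _ _ w u) => //; first exact: filter_uniq.
    by move=> t; rewrite mem_filter /= /p -ltnNge => /andP[/ltnW pt /wu[]].
  move=> t t'; rewrite !mem_filter => /andP[_ ts] /andP[_ ts'] ne.
  have := sep t t' ts ts' ne; rewrite -abszN; congr (_ <= `|_|)%N; lra.
lia.
Qed.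

Lemma dotC a x : dot a x = dot x a.
Proof. by apply: eq_bigr => i _; rewrite mulrC. Qed.

Lemma dot_delta a i : dot a (delta_mx 0 i) = a 0 i.
Proof.
rewrite /dot (bigD1 i) //= mxE !eqxx mulr1 big1 ?addr0 // => j ji.
by rewrite mxE eqxx (negPf ji) mulr0.
Qed.

(** The values of [a] form an ideal of Z with a generator g; as a/g is orthogonal to
    [x] too, minimality forces g = 1. *)
Lemma shortest_primitive A a x : shortest A a x -> exists z, dot a z = 1.
Proof.
move=> sA; have [a0 ax aA amin] := sA.
pose P k := `[< exists z, dot a z = k.+1%:Z >].
have exP : exists k, P k.
  have [i ai] := shortest_attained sA; have A0 := shortest_gt0 sA.
  exists A.-1; apply/asboolP; exists (Num.sg (a 0 i) *: delta_mx 0 i).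
  by rewrite dotC dotZ dotC dot_delta prednK // -ai abszE normrEsg.
have [k /asboolP[z zE] kmin] := ex_minnP exP.
have dv j : (k.+1%:Z %| a 0%R j)%Z.
  apply: contrapT => nd; pose r := (a 0%R j %% k.+1%:Z)%Z.
  have r0 : 0 <= r by apply: modz_ge0.
  have rk : r < k.+1%:Z by apply: ltz_pmod.
  have rn0 : r != 0 by apply/eqP => e; apply: nd; apply/dvdz_mod0P.
  have /kmin : P `|r|.-1.
    apply/asboolP; exists (delta_mx 0 j - (a 0%R j %/ k.+1%:Z)%Z *: z).
    by rewrite dotC dotB dotZ !(dotC _ a) dot_delta zE prednK ?absz_gt0 // gez0_abs.
  lia.
pose a' : Z4 := \row_j (a 0%R j %/ k.+1%:Z)%Z.
have aE : a = k.+1%:Z *: a'.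
  by apply/matrixP => i j; rewrite !ord1 !mxE mulrC divzK.
have a'0 : a' != 0 by apply: contraNneq a0 => e; rewrite aE e scaler0.
have a'x : dot a' x = 0.
  by apply/eqP; move/eqP: ax; rewrite aE dotZ mulf_eq0.
have [j Aj] := amin _ a'0 a'x.
exists z; rewrite zE; have := aA j; rewrite aE mxE abszM absz_nat => le.
have A0 := shortest_gt0 sA.
suff -> : k = 0%N by [].
move: Aj le; set t := `|_|%N => Aj le; nia.
Qed.

Lemma same_absz (p q : int) : `|p|%N = `|q|%N -> (0 < p) = (0 < q) -> p = q.
Proof. by case: (ltrP 0 p); case: (ltrP 0 q); lia. Qed.

Lemma sub_swap (p q r t : int) : p + q = r + t -> q - t = r - p.
Proof. lra. Qed.

Lemma sub_through (r r' p q : int) : r - r' = (q - r') - (p - r) + (p - q).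
Proof. lra. Qed.

(** The residue of the value of [a] modulo A takes every value on [0, A)^3, in the
    coordinates other than [i], because [a] is primitive.  Translating the points by
    representatives of the A residues gives A times as many distinct points in a
    box of side 2N + A in three coordinates. *)
Lemma plane_count A a x0 N (s : seq Z4) : shortest A a x0 -> uniq s ->
  (forall x, x \in s -> dot a x = 0 /\ norm_le N x) ->
  (A * size s <= (2 * N + A) ^ 3)%N.
Proof.
move=> sA us sP; have [z az] := shortest_primitive sA.
have [i ai] := shortest_attained sA; have A0 := shortest_gt0 sA.
have Ai : (A%:Z %| a 0%R i)%Z by rewrite dvdzE ai.
pose w (r : nat) (j : 'I_3) : int := ((r%:Z * z 0 (lift i j))%R %% A%:Z)%Z.
have w0 r (j : 'I_3) : 0 <= w r j by apply: modz_ge0; lia.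
have wA r (j : 'I_3) : w r j < A%:Z by apply: ltz_pmod.
pose f (p : 'I_A * Z4) : {ffun 'I_3 -> 'I_(2 * N + A).-1.+1} :=
  [ffun j => inord `|(p.2 0 (lift i j) + N%:Z + w p.1 j)%R|].
pose L := allpairs pair (enum 'I_A) s.
have sL : size L = (A * size s)%N by rewrite size_allpairs size_enum_ord.
rewrite -sL; have -> : ((2 * N + A) ^ 3 = #|{ffun 'I_3 -> 'I_(2 * N + A).-1.+1}|)%N.
  by rewrite card_ffun !card_ord prednK //; lia.
apply: (@uniq_size_inj _ _ L f).
  apply: allpairs_uniq => //; first exact: enum_uniq.
  by move=> [? ?] [? ?] _ _ [-> ->].
move=> [r x] [r' x'] /allpairsP[[r1 x1] /= [_ xs [-> ->]]] /allpairsP[[r2 x2] /= [_ xs' [-> ->]]].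
move: r1 r2 x1 x2 xs xs' => {r x r' x'} r r' x x' xs xs' fE.
have [ax xN] := sP x xs; have [ax' xN'] := sP x' xs'.
have E (j : 'I_3) : x 0 (lift i j) + w r j = x' 0 (lift i j) + w r' j.
  have := congr1 (fun g : {ffun 'I_3 -> 'I_(2 * N + A).-1.+1} => (g j : nat)) fE; rewrite !ffunE /=.
  have B1 := xN (lift i j); have B2 := xN' (lift i j).
  have := w0 r j; have := w0 r' j; have := wA r j; have := wA r' j => h1 h2 h3 h4.
  by rewrite !inordK; lia.
have W (q : nat) : (A%:Z %| (\sum_j a 0 (lift i j) * w q j - q%:Z)%R)%Z.
  have -> : \sum_j a 0 (lift i j) * w q j - q%:Z =
      \sum_j a 0 (lift i j) * (w q j - q%:Z * z 0 (lift i j)) - q%:Z * (a 0 i * z 0 i).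
    have := az; rewrite (dotD1 i) => /(congr1 (fun t => q%:Z * t)); rewrite mulr1 mulrDr big_distrr /=.
    move=> qE; have -> : \sum_j a 0 (lift i j) * (w q j - q%:Z * z 0 (lift i j)) =
        \sum_j a 0 (lift i j) * w q j - \sum_j q%:Z * (a 0 (lift i j) * z 0 (lift i j)).
      by rewrite -sumrB; apply: eq_bigr => j _; rewrite mulrBr [X in _ - X]mulrCA.
    by rewrite -[X in _ - X = _]qE opprD addrA addrAC.
  apply: rpredB; last by apply: dvdz_mull; apply: dvdz_mulr.
  apply: rpred_sum => j _; apply: dvdz_mull.
  by rewrite -[_ \in _]/(_ %| _)%Z -eqz_mod_dvd /w modz_mod.
have D : \sum_j a 0 (lift i j) * w r j - \sum_j a 0 (lift i j) * w r' j = a 0 i * (x 0 i - x' 0 i).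
  have -> : \sum_j a 0 (lift i j) * w r j - \sum_j a 0 (lift i j) * w r' j =
      \sum_j a 0 (lift i j) * x' 0 (lift i j) - \sum_j a 0 (lift i j) * x 0 (lift i j).
    rewrite -!sumrB; apply: eq_bigr => j _; rewrite -!mulrBr; congr (_ * _).
    exact: sub_swap (E j).
  move: ax ax'; rewrite !(dotD1 i) => /eqP; rewrite addr_eq0 => /eqP e1 /eqP.
  by rewrite addr_eq0 => /eqP e2; rewrite mulrBr e1 e2 opprK addrC.
have rr : r = r'.
  have : (A%:Z %| (r%:Z - r'%:Z)%R)%Z.
    rewrite (sub_through r%:Z r'%:Z (\sum_j a 0 (lift i j) * w r j)
      (\sum_j a 0 (lift i j) * w r' j)) D.
    by apply: rpredD; [apply: rpredB; apply: W|apply: dvdz_mulr].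
  rewrite -eqz_mod_dvd !modz_nat !modn_small // => /eqP[] ?; exact: val_inj.
subst r'; congr (_, _); apply/matrixP => i' k; rewrite !ord1.
case: (unliftP i k) => [j|] ->; first by apply: addIr (E j).
have ai0 : a 0 i != 0 by rewrite -absz_gt0 ai.
by have /esym/eqP := D; rewrite subrr mulf_eq0 (negPf ai0) subr_eq0 => /eqP.
Qed.

(** The coordinates other than [i] of a vector in a box of radius [K], as an element of a
    finite type. *)
Definition box_code K i x : {ffun 'I_3 -> 'I_(2 * K).+1} :=
  [ffun j => inord `|(x 0 (lift i j) + K%:Z)%R|].

Lemma box_code_inj K i x y : norm_le K x -> norm_le K y -> x 0 i = y 0 i ->
  box_code K i x = box_code K i y -> x = y.
Proof.
move=> xK yK xi eE; apply/matrixP => i' k; rewrite !ord1.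
case: (unliftP i k) => [j|] -> //.
have := congr1 (fun g : {ffun 'I_3 -> 'I_(2 * K).+1} => (g j : nat)) eE; rewrite !ffunE /=.
have := xK (lift i j); have := yK (lift i j) => B1 B2.
by rewrite !inordK; lia.
Qed.

Lemma card_box_code K : #|{ffun 'I_3 -> 'I_(2 * K).+1}| = ((2 * K).+1 ^ 3)%N.
Proof. by rewrite card_ffun !card_ord. Qed.

Lemma cube_bound K : (0 < K)%N -> ((2 * K).+1 ^ 3 <= 27 * K ^ 3)%N.
Proof.
move=> K0; rewrite -[27%N]/(3 ^ 3)%N -expnMn leq_exp2r //; lia.
Qed.

(** A vector is determined by the position and the sign of a coordinate of maximal
    absolute value, and by the three other coordinates. *)
Lemma count_norm A (s : seq Z4) : (0 < A)%N -> uniq s ->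
  (forall a, a \in s -> norm_le A a /\ exists i, `|(a 0 i)%R|%N = A) ->
  (size s <= 216 * A ^ 3)%N.
Proof.
move=> A0 us sP; pose mi a : 'I_4 := odflt ord0 [pick i | `|(a 0 i)%R|%N == A].
have miP a : a \in s -> `|(a 0 (mi a))%R|%N = A.
  move=> /sP[_ [i ai]]; rewrite /mi; case: pickP => [k /eqP//|/(_ i)].
  by rewrite ai eqxx.
have := @uniq_size_inj _ _ s (fun a => (mi a, 0 < a 0 (mi a), box_code A (mi a) a)) us.
rewrite !card_prod card_ord card_bool card_box_code => H.
apply: leq_trans (H _) _; last by have := cube_bound A0; lia.
move=> a b sa sb [mE sE eE]; have [aA _] := sP a sa; have [bA _] := sP b sb.
have am := miP a sa; have bm := miP b sb.
rewrite -mE in sE eE bm; apply: (box_code_inj aA bA) eE.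
by apply: same_absz sE; rewrite am bm.
Qed.

Lemma count_second A K i (s : seq Z4) : (0 < A)%N -> (0 < K)%N -> uniq s ->
  (forall b, b \in s -> norm_le K b /\ (`|(b 0 i)%R| < A)%N) ->
  (size s <= 54 * (A * K ^ 3))%N.
Proof.
move=> A0 K0 us sP.
have := @uniq_size_inj _ _ s (fun b => (inord `|(b 0 i + A%:Z)%R| : 'I_(2 * A).-1.+1, box_code K i b)) us.
rewrite card_prod card_ord card_box_code => H; apply: leq_trans (H _) _; last first.
  rewrite prednK; last by lia.
  by have := cube_bound K0; set t := (_ ^ 3)%N; nia.
move=> b c sb sc [iE eE]; have [bK bi] := sP b sb; have [cK ci] := sP c sc.
apply: (box_code_inj bK cK) eE; move: iE => /(congr1 (fun k : 'I_(2 * A).-1.+1 => (k : nat))).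
move: (b 0 i) (c 0 i) bi ci => p q bi ci; rewrite /= !inordK; lia.
Qed.
End Boxes.

(** * Points on a line *)

Lemma cramer_rat (p q a b a' b' : rat) :
  p * (a * b' - b * a') = (p * a + q * b) * b' - (p * a' + q * b') * b /\
  q * (a * b' - b * a') = (p * a' + q * b') * a - (p * a + q * b) * a'.
Proof. by split; lra. Qed.

Section RationalLines.
Implicit Types (a b v w : 'rV[rat]_4).

Lemma minorE (R : pzRingType) (x y : 'rV[R]_4) i j :
  minor x y i j = x 0 i * y 0 j - y 0 i * x 0 j.
Proof. by []. Qed.

Lemma minor_toQ (x y : Z4) i j : minor (toQ x) (toQ y) i j = (minor x y i j)%:~R.
Proof. by rewrite !minorE !mxE rmorphB !rmorphM. Qed.

Lemma orth_toQ (a x : Z4) : (toQ x *m (toQ a)^T == 0) = (dot a x == 0).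
Proof.
have -> : toQ x *m (toQ a)^T = (dot a x)%:~R%:M.
  apply/matrixP => i j; rewrite !ord1 !mxE eqxx mulr1n rmorph_sum /=.
  by apply: eq_bigr => k _; rewrite !mxE rmorphM mulrC.
apply/eqP/eqP => [/matrixP/(_ 0 0)|->]; last by rewrite raddf0.
by rewrite !mxE eqxx mulr1n => /eqP; rewrite intr_eq0 => /eqP.
Qed.

Lemma minor_row_free a b i j : minor a b i j != 0 -> row_free (col_mx a b).
Proof.
move=> m0; apply: inj_row_free => v; rewrite -[v]hsubmxK mul_row_col.
move: (lsubmx v) (rsubmx v) => p q /matrixP e.
have E k : p 0 0 * a 0 k + q 0 0 * b 0 k = 0.
  by have := e 0 k; rewrite !mxE !big_ord1.
have [e1 e2] := cramer_rat (p 0 0) (q 0 0) (a 0 i) (b 0 i) (a 0 j) (b 0 j).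
have p0 : p 0 0 = 0 by apply: (mulIf m0); rewrite minorE e1 !E !mul0r subrr.
have q0 : q 0 0 = 0 by apply: (mulIf m0); rewrite minorE e2 !E !mul0r subrr.
have -> : p = 0 by apply/matrixP => k l; rewrite !ord1 p0 mxE.
have -> : q = 0 by apply/matrixP => k l; rewrite !ord1 q0 mxE.
exact: row_mx0.
Qed.

(** The row space of [x], [y] has rank 2, as has the kernel that contains it. *)
Lemma line_span a b x y i j i' j' : minor a b i j != 0 -> minor x y i' j' != 0 ->
  x *m a^T = 0 -> x *m b^T = 0 -> y *m a^T = 0 -> y *m b^T = 0 ->
  forall v, v *m a^T = 0 -> v *m b^T = 0 -> exists w : 'rV[rat]_(1 + 1), v = w *m col_mx x y.
Proof.
move=> /minor_row_free mab /minor_row_free mxy xa xb ya yb v va vb.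
pose K := kermx (col_mx a b)^T.
have inK (m : nat) (u : 'M_(m, 4)) : u *m a^T = 0 -> u *m b^T = 0 -> (u <= K)%MS.
  by move=> ua ub; apply/sub_kermxP; rewrite tr_col_mx mul_mx_row ua ub row_mx0.
have sK : (col_mx x y <= K)%MS by apply: inK; rewrite mul_col_mx ?xa ?xb ?ya ?yb col_mx0.
have rK : \rank K = 2%N by rewrite mxrank_ker mxrank_tr (eqP mab).
have : (K <= col_mx x y)%MS.
  by rewrite -(mxrank_leqif_sup sK) rK (eqP mxy).
have vK := inK _ v va vb => /(submx_trans vK)/submxP[w wE]; by exists w.
Qed.

Lemma minor_span x y (w w' : 'rV[rat]_(1 + 1)) k l :
  minor (w *m col_mx x y) (w' *m col_mx x y) k l =
  (w 0 0 * w' 0 1 - w' 0 0 * w 0 1) * minor x y k l.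
Proof.
have E (u : 'rV[rat]_(1 + 1)) m : (u *m col_mx x y) 0 m = u 0 0 * x 0 m + u 0 1 * y 0 m.
  rewrite -{1}[u]hsubmxK mul_row_col !mxE !big_ord1 !mxE.
  by congr (u _ _ * _ + u _ _ * _); apply: val_inj.
rewrite !minorE !E.
move: (w 0 0) (w 0 1) (w' 0 0) (w' 0 1) (x 0 k) (x 0 l) (y 0 k) (y 0 l) => *; lra.
Qed.
End RationalLines.

Definition distinct_points (s : seq Z4) :=
  {in s &, forall x y, x != y -> exists i j, minor x y i j != 0}.

Lemma two_elements (T : eqType) (s : seq T) : uniq s -> (1 < size s)%N ->
  exists x y : T, [/\ x \in s, y \in s & x != y].
Proof.
case: s => [|x [|y s]] //= /andP[]; rewrite inE negb_or => /andP[xy _] _ _.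
by exists x, y; rewrite !inE !eqxx orbT.
Qed.

Lemma quarter_le n p : (n <= 4 * p)%N -> ((n + 3) %/ 4 <= p)%N.
Proof. lia. Qed.

Lemma quarter_bounds n (q := ((n + 3) %/ 4)%N) : (0 < n)%N ->
  [/\ (0 < q)%N, (n <= 4 * q)%N & (q <= n)%N].
Proof. by rewrite /q; split; lia. Qed.

Section OnLine.
Variables (d : nat) (F : {mpoly rat[4]}).
Hypotheses (d0 : (0 < d)%N) (hF : F \is d.-homog).
Implicit Types (a b x y : Z4) (s : seq Z4).

(** [few_zero_hyperplanes] on the line, parametrized by two of the points: a point of
    the line is a hyperplane of it. *)
Lemma points_on_line a b i j s (z : 'rV[rat]_4) : minor a b i j != 0 ->
  uniq s -> distinct_points s ->
  (forall x, x \in s -> [/\ dot a x = 0, dot b x = 0 & row_eval F (toQ x) = 0]) ->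
  z *m (toQ a)^T = 0 -> z *m (toQ b)^T = 0 -> row_eval F z != 0 -> (size s <= d)%N.
Proof.
move=> mab us ds sP za zb Fz.
have [|/(two_elements us)[x0 [y0 [x0s y0s ne]]]] := leqP (size s) 1; first by move=> h; apply: leq_trans h d0.
have [k [l mxy]] := ds _ _ x0s y0s ne.
have orth x : x \in s -> toQ x *m (toQ a)^T = 0 /\ toQ x *m (toQ b)^T = 0.
  by move=> /sP[ax bx _]; split; apply/eqP; rewrite orth_toQ; apply/eqP.
have mabQ : minor (toQ a) (toQ b) i j != 0 by rewrite minor_toQ intr_eq0.
have mxyQ : minor (toQ x0) (toQ y0) k l != 0 by rewrite minor_toQ intr_eq0.
have [x0a x0b] := orth _ x0s; have [y0a y0b] := orth _ y0s.
have span := line_span mabQ mxyQ x0a x0b y0a y0b.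
have [wz wzE] := span z za zb.
have /choice[w wE] : forall x, exists w : 'rV[rat]_(1 + 1), x \in s -> toQ x = w *m col_mx (toQ x0) (toQ y0).
  move=> x; have [xs|] := boolP (x \in s); last by exists 0.
  by have [xa xb] := orth x xs; have [w wE] := span _ xa xb; exists w.
pose L x : 'cV[rat]_(1 + 1) := \col_m if val m == 0%N then w x 0 1 else - w x 0 0.
have LE (u : 'rV[rat]_(1 + 1)) x : (u *m L x) 0 0 = u 0 0 * w x 0 1 - u 0 1 * w x 0 0.
  rewrite mxE big_ord_recl big_ord1 !mxE /=; congr (_ + _).
  by rewrite mulrN; congr (- (u _ _ * _)); apply: val_inj.
have mw x y m n : x \in s -> y \in s ->
    (minor x y m n)%:~R = (w x 0 0 * w y 0 1 - w y 0 0 * w x 0 1) * minor (toQ x0) (toQ y0) m n.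
  by move=> xs ys; rewrite -minor_toQ (wE x xs) (wE y ys) minor_span.
have dep x y c : x \in s -> y \in s -> L y = c *: L x -> x = y.
  move=> xs ys /matrixP e; apply/eqP; apply: contraT => xy.
  have e0 : w y 0 1 = c * w x 0 1 by have := e 0 0; rewrite !mxE.
  have e1 : w y 0 0 = c * w x 0 0.
    by have := e 1 0; rewrite !mxE /= mulrN => /oppr_inj.
  have [m [n]] := ds _ _ xs ys xy; rewrite -(intr_eq0 rat) mw // e0 e1.
  by rewrite mulrCA mulrA subrr mul0r eqxx.
rewrite -(size_map L).
apply: (@few_zero_hyperplanes _ d (fun u => row_eval F (u *m col_mx (toQ x0) (toQ y0))) _ wz).
- exact: row_eval_comp_line_degree.
- by rewrite -wzE.
- rewrite map_inj_in_uniq // => x y xs ys e; apply: (dep x y 1) => //.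
  by rewrite e scale1r.
- move=> _ u /mapP[x xs ->] /matrixP/(_ 0 0); rewrite LE mxE => /eqP; rewrite subr_eq0 => /eqP uE.
  have Fx : row_eval F (toQ x) = 0 by case: (sP x xs).
  suff [c ->] : exists c, u = c *: w x by rewrite -scalemxAl -wE // (row_eval_scale hF) Fx mulr0.
  have two (p q : 'rV[rat]_(1 + 1)) : p 0 0 = q 0 0 -> p 0 1 = q 0 1 -> p = q.
    move=> e0 e1; apply/matrixP => r t; rewrite ord1; case: t => [[|[|//]] lt].
      by rewrite (_ : Ordinal lt = 0) //; apply: val_inj.
    by rewrite (_ : Ordinal lt = 1) //; apply: val_inj.
  have [w00|w00] := eqVneq (w x 0 0) 0; last first.
    exists (u 0 0 / w x 0 0); apply: two; rewrite !mxE ?divfK //.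
    by rewrite mulrAC uE mulfK.
  have [w01|w01] := eqVneq (w x 0 1) 0.
    exfalso; have [y [ys xy]] : exists y, y \in s /\ x != y.
      have [e|] := eqVneq x x0; last by exists x0.
      by exists y0; rewrite e.
    have [m [n]] := ds _ _ xs ys xy.
    by rewrite -(intr_eq0 rat) mw // w00 w01 mul0r mulr0 subrr mul0r eqxx.
  exists (u 0 1 / w x 0 1); apply: two; rewrite !mxE ?divfK //.
  by rewrite mulrAC -uE mulfK.
- move=> _ _ /mapP[x xs ->] /mapP[y ys ->] ne1 c e.
  by move: ne1; rewrite (dep x y c xs ys e) eqxx.
Qed.

End OnLine.

(** Minors of two points of a line are proportional, so the same pair of coordinates
    [k], [l] is maximal for all of them, and [minor_lower_bound] separates the
    projections of the points to these coordinates. *)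
Lemma short_line_count (a b : Z4) i j (s : seq Z4) A N : minor a b i j != 0 -> (A <= 2 * N)%N ->
  uniq s -> distinct_points s ->
  (forall x, x \in s -> [/\ dot a x = 0, dot b x = 0, norm_le N x & shortest A a x]) ->
  (A ^ 2 * size s <= 48 * N ^ 2)%N.
Proof.
move=> mab AN us ds sP.
have A2 : (A ^ 2 <= 4 * N ^ 2)%N by rewrite -[4%N]/(2 ^ 2)%N -expnMn leq_exp2r.
have [h|/(two_elements us)[x0 [y0 [x0s y0s ne]]]] := leqP (size s) 1; first by nia.
have A0 : (0 < A)%N by case: (sP _ x0s) => _ _ _; apply: shortest_gt0.
have [k0 [l0 mxy]] := ds _ _ x0s y0s ne.
have orth x : x \in s -> toQ x *m (toQ a)^T = 0 /\ toQ x *m (toQ b)^T = 0.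
  by move=> /sP[ax bx _ _]; split; apply/eqP; rewrite orth_toQ; apply/eqP.
have mabQ : minor (toQ a) (toQ b) i j != 0 by rewrite minor_toQ intr_eq0.
have mxyQ : minor (toQ x0) (toQ y0) k0 l0 != 0 by rewrite minor_toQ intr_eq0.
have [x0a x0b] := orth _ x0s; have [y0a y0b] := orth _ y0s.
have span := line_span mabQ mxyQ x0a x0b y0a y0b.
have [[k l] /= klmax] : exists p : 'I_4 * 'I_4, forall q : 'I_4 * 'I_4,
    (`|minor x0 y0 q.1 q.2| <= `|minor x0 y0 p.1 p.2|)%N.
  by case: (@arg_maxnP _ (k0, l0) xpredT (fun q => `|minor x0 y0 q.1 q.2|%N) isT) => p _ H; exists p => q; apply: H.
have prop x y : x \in s -> y \in s -> exists lam : rat, forall m n,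
    (minor x y m n)%:~R = lam * (minor x0 y0 m n)%:~R.
  move=> xs ys; have [xa xb] := orth _ xs; have [ya yb] := orth _ ys.
  have [w wE] := span _ xa xb; have [w' w'E] := span _ ya yb.
  exists (w 0 0 * w' 0 1 - w' 0 0 * w 0 1) => m n.
  by rewrite -!minor_toQ wE w'E minor_span.
(* A^2 / 4 rounded up *)
pose D := ((A ^ 2 + 3) %/ 4)%N.
have sep x y : x \in s -> y \in s -> x != y -> (D <= `|minor x y k l|)%N.
  move=> xs ys xy; have [lam lamE] := prop x y xs ys.
  have [m [n mn0]] := ds _ _ xs ys xy.
  (* a pair of distinct points has some nonzero minor, and it is lam times a minor of the first pair *)
  have lam0 : lam != 0.
    apply: contraNneq mn0 => e; have := lamE m n; rewrite e mul0r => /eqP.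
    by rewrite intr_eq0.
  have kl0 : minor x0 y0 k l != 0.
    have := klmax (k0, l0); rewrite /= -absz_gt0; apply: leq_trans; by rewrite absz_gt0.
  have [_ _ _ [_ _ _ xmin]] := sP x xs.
  apply: quarter_le; apply: (minor_lower_bound xmin).
    by rewrite -(intr_eq0 rat) lamE mulf_neq0 // intr_eq0.
  move=> m' n'; rewrite -(ler_nat rat) !natr_absz !intr_norm !lamE !normrM.
  rewrite ler_wpM2l // -!intr_norm ler_int -!abszE lez_nat; exact: (klmax (m', n')).
have [D0 D1 D2] : [/\ (0 < D)%N, (A ^ 2 <= 4 * D)%N & (D <= A ^ 2)%N].
  by apply: quarter_bounds; rewrite expn_gt0 A0.
have H : (D * size s <= 4 * N ^ 2 + 2 * D)%N.
  apply: (@separated _ s (fun x => x 0 k) (fun x => x 0 l)) => // x xs.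
  by case: (sP x xs) => _ _ xN _; split.
have : (A ^ 2 * size s <= 4 * D * size s)%N by rewrite leq_mul2r D1 orbT.
by rewrite -mulnA => /leq_trans; apply; clear -H D2 A2; lia.
Qed.

(** * Points whose shortest normal vector is given *)

(** A canonical generator of the line spanned by [q]; it tells apart the lines of a plane. *)
Definition unit_pivot (n : nat) (q : 'cV[rat]_n) : 'cV[rat]_n :=
  (if [pick i | q i 0 != 0] is Some i then (q i 0)^-1 else 0) *: q.

Lemma unit_pivotE n (q : 'cV[rat]_n) : q != 0 -> exists2 c, c != 0 & unit_pivot q = c *: q.
Proof.
move=> q0; rewrite /unit_pivot; case: pickP => [i qi|H].
  by exists (q i 0)^-1; rewrite ?invr_eq0.
case/eqP: q0; apply/matrixP => i j; rewrite ord1 mxE; apply/eqP.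
by have := H i; case: eqP.
Qed.

Lemma unit_pivotZ n (q : 'cV[rat]_n) c : c != 0 -> unit_pivot (c *: q) = unit_pivot q.
Proof.
move=> c0; rewrite /unit_pivot.
rewrite (@eq_pick _ _ (fun i => q i 0 != 0)) => [|i]; last first.
  by rewrite /= mxE mulf_eq0 (negPf c0).
case: pickP => [i qi|_]; last by rewrite !scale0r.
by rewrite mxE scalerA invfM mulrAC mulVf // mul1r.
Qed.

Section ClassBound.
Variables (d : nat) (F : {mpoly rat[4]}).
Hypotheses (d0 : (0 < d)%N) (hF : F \is d.-homog).
Implicit Types (a b x y : Z4) (s : seq Z4).

Definition plane_in_zeros a := `[< forall v : 'rV[rat]_4, v *m (toQ a)^T = 0 -> row_eval F v = 0 >].

(** The points are sorted according to the second vector [b x] and to whether the line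
    orthogonal to [a] and [b x] lies in the zero set.  Otherwise, each [b] accounts for
    at most [d] points.  The lines in the zero set are at most [d], and
    [short_line_count] applies to each; they are identified by the linear form [b x]
    on the plane up to a scalar, since different [b x] can define the same line. *)
Lemma class_bound a i A N K s : `|(a 0 i)%R|%N = A -> (0 < N)%N -> (A <= 2 * N)%N ->
  (A <= K)%N -> (8 * N <= A * K ^ 2)%N -> ~~ plane_in_zeros a ->
  uniq s -> distinct_points s ->
  (forall x, x \in s -> [/\ norm_le N x, row_eval F (toQ x) = 0 & shortest A a x]) ->
  (A ^ 2 * size s <= d * (54 * (A ^ 3 * K ^ 3) + 48 * N ^ 2))%N.
Proof.
move=> ai N0 AN AK NK /asboolPn/existsNP[z /not_implyP[za /eqP Fz]] us ds sP.
have [->|snil] := eqVneq s [::]; first by rewrite muln0.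
have [x1 x1s] : exists x, x \in s by case: (s) snil => // x ?; exists x; rewrite mem_head.
have A0 : (0 < A)%N by case: (sP _ x1s) => _ _; apply: shortest_gt0.
have K0 : (0 < K)%N by apply: leq_trans AK.
have /choice[b bP] : forall x, exists b, x \in s ->
    [/\ dot b x = 0, (`|(b 0 i)%R| < A)%N, norm_le K b & exists j, minor a b i j != 0].
  move=> x; have [xs|] := boolP (x \in s); last by exists 0.
  have [xN _ sA] := sP x xs.
  by have [b H] := exists_second sA ai xN AK N0 NK; exists b.
have ax x : x \in s -> dot a x = 0 by move=> /sP[_ _ []].
pose bad x := `[< forall v : 'rV[rat]_4, v *m (toQ a)^T = 0 -> v *m (toQ (b x))^T = 0 -> row_eval F v = 0 >].
have sub_ds (p : pred Z4) : distinct_points (filter p s).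
  by move=> x y; rewrite !mem_filter => /andP[_ xs] /andP[_ ys]; apply: ds.
have H1 : (1 * size (filter (predC bad) s) <=
    size (undup (map b (filter (predC bad) s))) * d)%N.
  apply: size_partition => x; rewrite mem_filter => /andP[/asboolPn nb xs].
  move/existsNP: nb => [v /not_implyP[va /not_implyP[vb /eqP Fv]]].
  rewrite mul1n -size_filter -filter_predI; have [_ _ _ [j mab]] := bP x xs.
  apply: (points_on_line d0 hF mab _ (sub_ds _) _ va vb Fv); first exact: filter_uniq.
  move=> y; rewrite mem_filter /= => /andP[/andP[/eqP by_ _] ys].
  have [yN Fy _] := sP y ys; split=> //; first exact: ax.
  by have [+ _ _ _] := bP y ys; rewrite by_.
have H1' : (size (undup (map b (filter (predC bad) s))) <= 54 * (A * K ^ 3))%N.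
  apply: (count_second (i := i)) => //; first exact: undup_uniq.
  move=> c; rewrite mem_undup => /mapP[x]; rewrite mem_filter => /andP[_ xs] ->.
  by have [] := bP x xs.
pose U := kermx (toQ a)^T.
pose fn x := U *m (toQ (b x))^T.
have Ua (u : 'rV_4) : u *m U *m (toQ a)^T = 0 by rewrite -mulmxA mulmx_ker mulmx0.
have fn0 x : x \in s -> fn x != 0.
  move=> xs; have [_ _ _ [j mab]] := bP x xs; apply: contraNneq mab => f0.
  (* a vector orthogonal to a, on which b x takes the value of their minor *)
  pose v : 'rV[rat]_4 := (a 0 i)%:~R *: delta_mx 0 j - (a 0 j)%:~R *: delta_mx 0 i.
  have ev (c : Z4) : (v *m (toQ c)^T) 0 0 = (minor a c i j)%:~R.
    rewrite mulmxBl -!scalemxAl -!rowE !mxE minorE rmorphB !rmorphM /=.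
    by rewrite [X in _ - X]mulrC.
  have vU : (v <= U)%MS.
    apply/sub_kermxP/matrixP => p q; rewrite !ord1 ev mxE minorE.
    by rewrite subrr.
  have /submxP[u uE] := vU.
  by rewrite -(intr_eq0 rat) -ev uE -mulmxA -/(fn x) f0 mulmx0 mxE.
pose key x := unit_pivot (fn x).
have H2 : (A ^ 2 * size (filter bad s) <=
    size (undup (map key (filter bad s))) * (48 * N ^ 2))%N.
  apply: size_partition => x; rewrite mem_filter => /andP[_ xs].
  rewrite -size_filter -filter_predI; have [_ _ _ [j mab]] := bP x xs.
  apply: (short_line_count mab AN _ (sub_ds _)); first exact: filter_uniq.
  move=> y; rewrite mem_filter /= => /andP[/andP[/eqP kE _] ys].
  have [yN Fy sA] := sP y ys; split=> //; first exact: ax.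
  apply/eqP; rewrite -orth_toQ.
  have : (toQ y <= U)%MS by apply/sub_kermxP/eqP; rewrite orth_toQ; apply/eqP/ax.
  move=> /submxP[u uE]; rewrite uE -mulmxA -/(fn x).
  have [c c0 cE] := unit_pivotE (fn0 x xs); have [c' c'0 cE'] := unit_pivotE (fn0 y ys).
  have -> : fn x = (c^-1 * c') *: fn y.
    by rewrite -scalerA -cE' -/(key y) kE /key cE scalerA mulVf // scale1r.
  rewrite -scalemxAr /fn mulmxA -uE.
  have [/eqP by0 _ _ _] := bP y ys.
  by move: by0; rewrite -orth_toQ => /eqP ->; rewrite scaler0.
have H2' : (size (undup (map key (filter bad s))) <= d)%N.
  have zU : (z <= U)%MS by apply/sub_kermxP.
  have /submxP[uz uzE] := zU.
  apply: (@few_zero_hyperplanes _ d (fun u => row_eval F (u *m U)) _ uz).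
  - exact: row_eval_comp_line_degree.
  - by rewrite -uzE.
  - exact: undup_uniq.
  - move=> l u; rewrite mem_undup => /mapP[x]; rewrite mem_filter => /andP[/asboolP bx xs] ->.
    have [c c0 cE] := unit_pivotE (fn0 x xs); rewrite /key cE -scalemxAr => /eqP.
    rewrite scaler_eq0 (negPf c0) /= => /eqP e; apply: bx; first exact: Ua.
    by rewrite -mulmxA.
  - move=> l l'; rewrite !mem_undup => /mapP[x]; rewrite mem_filter => /andP[_ xs] lE.
    move=> /mapP[y]; rewrite mem_filter => /andP[_ ys] l'E ne c e.
    have [r r0 rE] := unit_pivotE (fn0 x xs); have [r' r'0 r'E] := unit_pivotE (fn0 y ys).
    have c0 : c != 0.
      apply: contraNneq (fn0 y ys) => c0; move: e; rewrite c0 scale0r l'E /key r'E => /eqP.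
      by rewrite scaler_eq0 (negPf r'0).
    case/eqP: ne; rewrite lE l'E /key -(unit_pivotZ (fn x) (mulf_neq0 c0 r0)) -scalerA -rE.
    rewrite -/(key x) -lE -e l'E /key r'E unit_pivotZ //.
have -> : size s = (size (filter (predC bad) s) + size (filter bad s))%N.
  by rewrite !size_filter addnC count_predC.
have T1 : (size (filter (predC bad) s) <= 54 * (A * K ^ 3) * d)%N.
  by move: H1; rewrite mul1n => /leq_trans; apply; rewrite leq_mul2r H1' orbT.
have T2 : (A ^ 2 * size (filter bad s) <= d * (48 * N ^ 2))%N.
  by apply: leq_trans H2 _; rewrite leq_mul2r H2' orbT.
have T3 : (A ^ 2 * size (filter (predC bad) s) <= A ^ 2 * (54 * (A * K ^ 3) * d))%N.
  by rewrite leq_mul2l T1 orbT.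
rewrite mulnDr mulnDr; apply: leq_add => //; apply: leq_trans T3 _.
have -> : (A ^ 3 = A ^ 2 * A)%N by rewrite expnSr.
by apply: eq_leq; move: (A ^ 2)%N (K ^ 3)%N => p q; clear; nia.
Qed.

(** Of [a] and [- a], one is selected: the first nonzero coordinate is positive. *)
Definition normalized a := if [pick i | a 0 i != 0] is Some i then 0 < a 0 i else true.

Lemma normalizedN a : normalized a || normalized (- a).
Proof.
rewrite /normalized (@eq_pick _ (fun i => (- a) 0 i != 0) (fun i => a 0 i != 0)) => [|i]; last first.
  by rewrite /= mxE oppr_eq0.
by case: pickP => // i ai; rewrite mxE oppr_gt0; case: ltgtP ai.
Qed.

Lemma normalized_pos a b (r : rat) : a != 0 -> normalized a -> normalized b -> r != 0 ->
  toQ b = r *: toQ a -> 0 < r.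
Proof.
move=> a0 na nb r0 /matrixP E.
have bE i : (b 0 i)%:~R = r * (a 0 i)%:~R :> rat by have := E 0 i; rewrite !mxE.
move: na nb; rewrite /normalized (@eq_pick _ (fun i => b 0 i != 0) (fun i => a 0 i != 0)) => [|i]; last first.
  by rewrite /= -!(intr_eq0 rat) bE mulf_eq0 (negPf r0).
case: pickP => [i ai ai0 bi0|H]; last first.
  case/eqP: a0; apply/matrixP => i j; rewrite ord1 mxE; apply/eqP.
  by have := H j; case: eqP.
move: ai0 bi0; rewrite -!(ltr_int rat) bE => ai0; by rewrite pmulr_lgt0.
Qed.

(** Each vector is orthogonal to the point of the other one, so their norms agree. *)
Lemma shortest_proportional A B a b x y (r : rat) :
  shortest A a x -> shortest B b y -> normalized a -> normalized b ->
  toQ b = r *: toQ a -> a = b.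
Proof.
move=> sA sB na nb E; have [a0 ax aA amin] := sA; have [b0 by_ bB bmin] := sB.
have bE i : (b 0 i)%:~R = r * (a 0 i)%:~R :> rat.
  by have := congr1 (fun v : 'rV[rat]_4 => v 0 i) E; rewrite !mxE.
have r0 : r != 0.
  apply: contraNneq b0 => r0; apply/eqP/matrixP => i j; rewrite ord1 [RHS]mxE.
  by apply/eqP; rewrite -(intr_eq0 rat) bE r0 mul0r.
have bx : dot b x = 0.
  apply/eqP; rewrite -orth_toQ E linearZ /= -scalemxAr.
  by move/eqP: ax; rewrite -orth_toQ => /eqP ->; rewrite scaler0.
have ay : dot a y = 0.
  apply/eqP; rewrite -orth_toQ (_ : toQ a = r^-1 *: toQ b); last first.
    by rewrite E scalerA mulVf // scale1r.
  rewrite linearZ /= -scalemxAr.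
  by move/eqP: by_; rewrite -orth_toQ => /eqP ->; rewrite scaler0.
have [i ai] := shortest_attained sA; have [j bj] := shortest_attained sB.
have A0 := shortest_gt0 sA; have B0 := shortest_gt0 sB.
have AB : A = B.
  have [k Ak] := amin b b0 bx; have [l Bl] := bmin a a0 ay.
  apply/eqP; rewrite eqn_leq (leq_trans Ak) //= ?(leq_trans Bl) //.
move: bB bj; rewrite -AB => bB bj.
have nE k : (`|(b 0 k)%R|)%:R = r * (`|(a 0 k)%R|)%:R :> rat.
  have rp := normalized_pos a0 na nb r0 E.
  by rewrite !natr_absz !intr_norm bE normrM gtr0_norm.
have r1 : r = 1.
  have Aq : 0 < A%:R :> rat by rewrite ltr0n.
  have h1 : r * A%:R <= 1 * A%:R by rewrite -{1}ai -nE mul1r ler_nat bB.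
  have h2 : 1 * A%:R <= r * A%:R.
    rewrite -{1}bj mul1r nE ler_pM2l ?ler_nat ?aA //; exact: normalized_pos a0 na nb r0 E.
  by move: h1 h2; rewrite !ler_pM2r // => h1 h2; apply/eqP; rewrite eq_le h1.
apply/matrixP => p k; rewrite !ord1; apply/eqP; rewrite -(eqr_int rat).
by rewrite bE r1 mul1r.
Qed.

Lemma card_planes_in_zeros s : F != 0 -> uniq s ->
  (forall a, a \in s -> [/\ plane_in_zeros a, normalized a & exists A x, shortest A a x]) ->
  (size s <= d)%N.
Proof.
move=> /mpoly_nonvanishing[v Fv] us sP.
rewrite -(size_map (fun a => (toQ a)^T)).
have prop a b c : a \in s -> b \in s -> (toQ b)^T = c *: (toQ a)^T -> a = b.
  move=> /sP[_ na [A [x sA]]] /sP[_ nb [B [y sB]]] e.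
  apply: (shortest_proportional sA sB na nb (r := c)).
  by apply: trmx_inj; rewrite e linearZ.
apply: (@few_zero_hyperplanes _ d (row_eval F) _ (\row_i v i)).
- exact: row_eval_line_degree.
- by rewrite /row_eval (@meval_eq _ _ _ v) // => i; rewrite mxE.
- rewrite map_inj_in_uniq // => a b sa sb e; apply: (prop a b 1) => //.
  by rewrite e scale1r.
- by move=> _ u /mapP[a /sP[/asboolP za _ _] ->]; apply: za.
- move=> _ _ /mapP[a sa ->] /mapP[b sb ->] ne c e.
  by move: ne; rewrite (prop a b c sa sb e) eqxx.
Qed.
End ClassBound.

(** * Summation over the normal vectors *)

(** The least [K] with [64 * N <= A * K ^ 2]; the constant 64 is what makes [A <= K]. *)
Lemma second_radius A M N : (0 < A)%N -> (A <= 2 * M)%N -> (M ^ 3 <= 8 * N)%N ->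
  (M <= N)%N -> (0 < N)%N ->
  exists K, [/\ (A <= K)%N, (64 * N <= A * K ^ 2)%N & (A * K ^ 2 <= 256 * N)%N].
Proof.
move=> A0 AM MN MleN N0.
have ex0 : exists K, (64 * N <= A * K ^ 2)%N.
  exists (64 * N)%N; rewrite -[X in (X <= _)%N]mul1n; apply: leq_mul => //.
  by rewrite -[X in (X <= _)%N]expn1 leq_pexp2l // muln_gt0.
have [K KN Kmin] := ex_minnP ex0; exists K; split=> //.
  rewrite -leq_sqr -(leq_pmul2l A0); apply: leq_trans KN.
  have : (A ^ 3 <= (2 * M) ^ 3)%N by rewrite leq_exp2r.
  by rewrite -expnS expnMn => /leq_trans; apply; rewrite -[(2 ^ 3)%N]/8%N; lia.
case: K KN Kmin => [|[|K]] KN Kmin.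
- by move: KN; rewrite muln0 leqn0 muln_eq0 /=; lia.
- by move: KN; rewrite muln1; lia.
have lt : (A * K.+1 ^ 2 < 64 * N)%N by rewrite ltnNge; apply/negP => /Kmin; lia.
have : (K.+2 ^ 2 <= 4 * K.+1 ^ 2)%N by rewrite -[4%N]/(2 ^ 2)%N -expnMn leq_sqr; lia.
move=> /(leq_mul (leqnn A)) /leq_trans; apply.
by rewrite mulnCA; lia.
Qed.

Lemma cancel_square A sz B : (0 < A)%N -> (A ^ 2 * sz <= 216 * A ^ 3 * B)%N ->
  (sz <= 216 * (A * B))%N.
Proof.
move=> A0 H; rewrite -(@leq_pmul2l (A ^ 2)) ?expn_gt0 ?A0 //.
apply: leq_trans H _; apply: eq_leq.
by rewrite (expnSr A 2); move: (A ^ 2)%N => p; clear; nia.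
Qed.

Lemma cancel_linear A H sz n : (0 < A)%N -> (A <= H)%N ->
  (A * sz <= 216 * A ^ 3 * (64 * n))%N -> (sz <= 216 * 64 * (H ^ 2 * n))%N.
Proof.
move=> A0 AH L; rewrite -(leq_pmul2l A0); apply: leq_trans L _.
have : (A ^ 2 <= H ^ 2)%N by rewrite leq_exp2r.
rewrite (expnS A 2) => /(leq_mul (leqnn (A * n)%N)).
by move: (A ^ 2)%N (H ^ 2)%N => p q; clear; nia.
Qed.

(** The square of [A ^ 3 * K] is A^5 (A K^2), hence at most (2M)^5 256 M^3 = 8192 M^8,
    and 8192 <= 91^2. *)
Lemma class_arith A K M N : (A <= 2 * M)%N -> (N <= M ^ 3)%N -> (A * K ^ 2 <= 256 * N)%N ->
  (A * (54 * (A ^ 3 * K ^ 3) + 48 * N ^ 2) <=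
   54 * (91 * (256 * (M ^ 4 * N))) + 96 * (M * N ^ 2))%N.
Proof.
move=> AM NM AK; rewrite mulnDr; apply: leq_add; last first.
  by rewrite mulnCA; have := leq_mul AM (leqnn (N ^ 2)%N); lia.
have A3K : (A ^ 3 * K <= 91 * M ^ 4)%N.
  rewrite -leq_sqr.
  have -> : ((A ^ 3 * K) ^ 2 = A ^ 5 * (A * K ^ 2))%N.
    by rewrite expnMn -expnM (_ : (3 * 2 = 5.+1)%N) // expnSr mulnA.
  have -> : ((91 * M ^ 4) ^ 2 = 91 * 91 * M ^ (4 * 2))%N by rewrite expnMn -expnM.
  have A5 : (A ^ 5 <= 32 * M ^ 5)%N by rewrite -[32%N]/(2 ^ 5)%N -expnMn leq_exp2r.
  apply: leq_trans (leq_mul A5 AK) _.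
  have M8 : (M ^ 5 * N <= M ^ (4 * 2))%N by rewrite (_ : (4 * 2 = 5 + 3)%N) // expnD leq_mul2l NM orbT.
  move: M8; set m := (M ^ (4 * 2))%N; rewrite mulnACA; set q := (M ^ 5 * N)%N; clear; lia.
have -> : (A * (54 * (A ^ 3 * K ^ 3)) = 54 * ((A ^ 3 * K) * (A * K ^ 2)))%N.
  by rewrite (expnSr K 2); move: (A ^ 3)%N (K ^ 2)%N => p q; clear; nia.
rewrite leq_mul2l /=; apply: leq_trans (leq_mul A3K AK) _.
by apply: eq_leq; move: (M ^ 4)%N => p; clear; nia.
Qed.

Section Count.
Variables (d N M H : nat) (F : {mpoly rat[4]}) (s : seq Z4).
Hypotheses (d0 : (0 < d)%N) (hF : F \is d.-homog) (F0 : F != 0).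
Hypotheses (N0 : (0 < N)%N) (NM : (N <= M ^ 3)%N) (MN : (M ^ 3 <= 8 * N)%N) (MleN : (M <= N)%N).
Hypotheses (H0 : (0 < H)%N) (dH : (d <= H ^ 4)%N).
Hypotheses (us : uniq s) (ds : distinct_points s).
Hypothesis sP : forall x, x \in s -> norm_le N x /\ row_eval F (toQ x) = 0.

Variable normal : Z4 -> Z4.
Variable normal_norm : Z4 -> nat.
Hypothesis normalP : forall x, x \in s ->
  [/\ (normal_norm x <= 2 * M)%N, shortest (normal_norm x) (normal x) x & normalized (normal x)].

Lemma filter_distinct (p : pred Z4) : distinct_points (filter p s).
Proof. by move=> x y; rewrite !mem_filter => /andP[_ xs] /andP[_ ys]; apply: ds. Qed.

Lemma size_by_norm (p : pred Z4) B J : (0 < J)%N ->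
  (forall x, x \in s -> p x -> (normal_norm x <= J)%N) ->
  (forall A, (0 < A <= J)%N -> (size [seq x <- s | p x & normal_norm x == A] <= B)%N) ->
  (size (filter p s) <= J * B)%N.
Proof.
move=> J0 pJ HB.
have normal_norm_le x : x \in filter p s -> (0 < normal_norm x <= J)%N.
  rewrite mem_filter => /andP[px xs]; rewrite pJ // andbT.
  by have [_ sx _] := normalP xs; apply: shortest_gt0 sx.
have : (1 * size (filter p s) <= size (undup (map normal_norm (filter p s))) * B)%N.
  apply: size_partition => x xs; rewrite mul1n -size_filter -filter_predI.
  apply: leq_trans (HB (normal_norm x) (normal_norm_le x xs)); rewrite leq_eqVlt; apply/orP; left; apply/eqP.
  by congr size; apply: eq_filter => y /=; rewrite andbC.
rewrite mul1n => /leq_trans; apply; rewrite leq_mul2r; apply/orP; right.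
rewrite -(size_iota 1 J); apply: uniq_leq_size; first exact: undup_uniq.
move=> k; rewrite mem_undup mem_iota => /mapP[x xs ->].
by have := normal_norm_le x xs; lia.
Qed.

Lemma count_normals A (p : pred Z4) : (0 < A)%N ->
  (size (undup (map normal [seq x <- s | p x & normal_norm x == A])) <= 216 * A ^ 3)%N.
Proof.
move=> A0; apply: count_norm => //; first exact: undup_uniq.
move=> a; rewrite mem_undup => /mapP[x]; rewrite mem_filter => /andP[/andP[_ /eqP nx] xs] ->.
have [_ sx _] := normalP xs; rewrite nx in sx; split; first by case: sx.
exact: shortest_attained sx.
Qed.

Lemma count_off_planes :
  (size [seq x <- s | ~~ plane_in_zeros F (normal x)] <=
   2 * M * (216 * (d * (54 * (91 * (256 * (M ^ 4 * N))) + 96 * (M * N ^ 2)))))%N.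
Proof.
have M0 : (0 < M)%N by rewrite lt0n; apply: contraTneq NM => ->; rewrite -ltnNge.
apply: size_by_norm => [|x xs _|A /andP[A0 AM]]; first by rewrite muln_gt0.
  by have [] := normalP xs.
have [K [AK K1 K2]] := second_radius A0 AM MN MleN N0.
set t := filter _ s.
have H1 : (A ^ 2 * size t <=
    size (undup (map normal t)) * (d * (54 * (A ^ 3 * K ^ 3) + 48 * N ^ 2)))%N.
  apply: size_partition => x; rewrite mem_filter => /andP[/andP[nz /eqP nx] xs].
  rewrite -size_filter -filter_predI; have [_ sx _] := normalP xs; rewrite nx in sx.
  have [i xi] := shortest_attained sx.
  apply: (class_bound d0 hF xi N0 _ AK _ nz _ (@filter_distinct _)).
  - by apply: leq_trans AM _; rewrite leq_mul2l MleN.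
  - by apply: leq_trans K1; rewrite leq_mul2r orbT.
  - exact: filter_uniq.
  move=> y; rewrite mem_filter /= => /andP[/andP[/eqP e /andP[_ /eqP ny]] ys].
  have [yN Fy] := sP ys; have [_ sy _] := normalP ys.
  by split=> //; rewrite -e -ny.
have := leq_trans H1 (leq_mul (count_normals (fun x => ~~ plane_in_zeros F (normal x)) A0) (leqnn _)).
move=> /(cancel_square A0) /leq_trans; apply; rewrite leq_mul2l /=.
by rewrite mulnCA leq_mul2l class_arith ?orbT.
Qed.

Lemma plane_fibre x : x \in s -> (normal_norm x * size [seq y <- s | normal y == normal x] <= 64 * N ^ 3)%N.
Proof.
move=> xs; have [nM sx _] := normalP xs.
apply: leq_trans (plane_count (N := N) (s := [seq y <- s | normal y == normal x]) sx _ _) _.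
- exact: filter_uniq.
- move=> y; rewrite mem_filter => /andP[/eqP <- ys]; have [yN _] := sP ys.
  by have [_ [_ ? _ _] _] := normalP ys.
have le : (2 * N + normal_norm x <= 4 * N)%N by lia.
by rewrite -[64%N]/(4 ^ 3)%N -expnMn leq_exp2r.
Qed.

(** The vectors of norm A contribute O(A^3) O(N^3 / A), which is at most O(H^2 N^3). *)
Lemma count_small_planes :
  (size [seq x <- s | plane_in_zeros F (normal x) && (normal_norm x <= H)%N] <= H * (216 * 64 * (H ^ 2 * N ^ 3)))%N.
Proof.
apply: size_by_norm => [//|x _ /andP[]//|A /andP[A0 AH]].
set t := filter _ s.
have H1 : (A * size t <= size (undup (map normal t)) * (64 * N ^ 3))%N.
  apply: size_partition => x; rewrite mem_filter => /andP[/andP[_ /eqP nx] xs].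
  rewrite -nx; apply: leq_trans (plane_fibre xs); rewrite leq_mul2l; apply/orP; right.
  by rewrite size_filter count_filter; apply: sub_count => y /= /andP[].
have := leq_trans H1 (leq_mul (count_normals (fun x => plane_in_zeros F (normal x) && (normal_norm x <= H)%N) A0) (leqnn _)).
exact: cancel_linear.
Qed.

(** There are at most d <= H^4 such planes, each with O(N^3 / H) points. *)
Lemma count_large_planes :
  (size [seq x <- s | plane_in_zeros F (normal x) && (H < normal_norm x)%N] <= 64 * (H ^ 3 * N ^ 3))%N.
Proof.
set t := filter _ s.
have H1 : (H * size t <= size (undup (map normal t)) * (64 * N ^ 3))%N.
  apply: size_partition => x; rewrite mem_filter => /andP[/andP[_ nx] xs].
  apply: leq_trans (plane_fibre xs); apply: leq_mul; first exact: ltnW.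
  by rewrite size_filter count_filter; apply: sub_count => y /= /andP[].
have H2 : (size (undup (map normal t)) <= d)%N.
  apply: (card_planes_in_zeros hF F0); first exact: undup_uniq.
  move=> a; rewrite mem_undup => /mapP[x]; rewrite mem_filter => /andP[/andP[zx _] xs] ->.
  by have [_ sx nx] := normalP xs; split=> //; exists (normal_norm x), x.
have := leq_trans H1 (leq_mul (leq_trans H2 dH) (leqnn _)).
by rewrite expnS -mulnA leq_pmul2l // mulnCA.
Qed.

Lemma count_total : (size s <= 2 * (216 * (54 * (91 * (256 * 8)) + 96)) * (d * (M ^ 2 * N ^ 2)) +
   (216 * 64 + 64) * (H ^ 3 * N ^ 3))%N.
Proof.
have -> : size s = (size [seq x <- s | ~~ plane_in_zeros F (normal x)] +
   (size [seq x <- s | plane_in_zeros F (normal x) && (normal_norm x <= H)%N] +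
    size [seq x <- s | plane_in_zeros F (normal x) && (H < normal_norm x)%N]))%N.
  rewrite !size_filter -(count_predC (fun x => plane_in_zeros F (normal x)) s) addnC; congr (_ + _)%N.
  elim: (s) => //= x t ->; rewrite ltnNge.
  by case: (plane_in_zeros F (normal x)); case: (leqP (normal_norm x) H) => _ /=; lia.
apply: leq_add.
  apply: leq_trans count_off_planes _.
  have E1 : (M * (M ^ 4 * N) <= 8 * (M ^ 2 * N ^ 2))%N.
    have -> : (M * (M ^ 4 * N) = M ^ 3 * (M ^ 2 * N))%N by rewrite mulnA -expnS (expnD M 3 2) -mulnA.
    apply: leq_trans (leq_mul MN (leqnn _)) _; apply: eq_leq.
    by rewrite (expnS N 1) expn1; move: (M ^ 2)%N => p; clear; nia.
  have E2 : (M * (M * N ^ 2) = M ^ 2 * N ^ 2)%N by rewrite mulnA.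
  set a := (M ^ 2 * N ^ 2)%N in E1 E2 *.
  have E : (M * (54 * (91 * (256 * (M ^ 4 * N))) + 96 * (M * N ^ 2)) <=
      (54 * (91 * (256 * 8)) + 96) * a)%N.
    by rewrite mulnDr mulnDl -E2; apply: leq_add; lia.
  have -> : (2 * M * (216 * (d * (54 * (91 * (256 * (M ^ 4 * N))) + 96 * (M * N ^ 2)))) =
     2 * (216 * (d * (M * (54 * (91 * (256 * (M ^ 4 * N))) + 96 * (M * N ^ 2))))))%N.
    by move: (54 * _ + _)%N => p; clear; nia.
  have := leq_mul (leqnn d) E; move: (_ + 96)%N => k; clear; nia.
rewrite mulnDl; apply: leq_add; last exact: count_large_planes.
apply: leq_trans count_small_planes _; apply: eq_leq.
by rewrite mulnCA (mulnA H) -expnS.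
Qed.
End Count.

(** * Points of bounded height on a surface *)

Lemma ceil_root n k : (0 < n)%N -> (0 < k)%N ->
  exists M, [/\ (0 < M)%N, (n <= M ^ k)%N, (M ^ k <= 2 ^ k * n)%N & (M <= n)%N].
Proof.
move=> n0 k0.
have exn : exists M, (n <= M ^ k)%N.
  by exists n; rewrite -{1}[n]expn1 leq_pexp2l.
have [M Mn Mmin] := ex_minnP exn; exists M.
have M0 : (0 < M)%N.
  by rewrite lt0n; apply: contraTneq Mn => ->; rewrite exp0n // -ltnNge.
split=> //; last by apply: Mmin; rewrite -{1}[n]expn1 leq_pexp2l.
case: M M0 Mn Mmin => [//|[|M]] _ Mn Mmin.
  by rewrite exp1n -[1%N]muln1 leq_mul // expn_gt0.
have lt : (M.+1 ^ k < n)%N by rewrite ltnNge; apply/negP => /Mmin; rewrite ltnn.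
apply: leq_trans (_ : (2 * M.+1) ^ k <= _)%N; first by rewrite leq_exp2r //; lia.
by rewrite expnMn leq_mul2l ltnW ?orbT.
Qed.

Lemma shortest_opp A (a x : Z4) : shortest A a x -> shortest A (- a) x.
Proof.
move=> [a0 ax aA amin]; split=> //; first by rewrite oppr_eq0.
  by rewrite dotN ax oppr0.
by move=> i; rewrite mxE abszN.
Qed.

Lemma integer_points_bound : exists C : nat, forall d N M H (F : {mpoly rat[4]}) (s : seq Z4),
  (0 < d)%N -> F \is d.-homog -> F != 0 ->
  (0 < N)%N -> (N <= M ^ 3)%N -> (M ^ 3 <= 8 * N)%N -> (M <= N)%N ->
  (0 < H)%N -> (d <= H ^ 4)%N -> uniq s -> distinct_points s ->
  (forall x, x \in s -> norm_le N x /\ row_eval F (toQ x) = 0) ->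
  (size s <= C * (d * (M ^ 2 * N ^ 2) + H ^ 3 * N ^ 3))%N.
Proof.
(* the two constants are kept abstract so that they are not computed in unary *)
have [c1 c1E] : exists c, c = (2 * (216 * (54 * (91 * (256 * 8)) + 96)))%N by eexists.
have [c2 c2E] : exists c, c = (216 * 64 + 64)%N by eexists.
exists (c1 + c2)%N => d N M H F s d0 hF F0 N0 NM MN MleN H0 dH us ds sP.
have M0 : (0 < M)%N by rewrite lt0n; apply: contraTneq NM => ->; rewrite -ltnNge.
have /choice[an anP] : forall x : Z4, exists an : Z4 * nat, x \in s ->
    [/\ (an.2 <= 2 * M)%N, shortest an.2 an.1 x & normalized an.1].
  move=> x; have [xs|] := boolP (x \in s); last by exists (0, 0%N).
  have [xN _] := sP x xs; have [A [a [AM sA]]] := exists_shortest xN M0 NM.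
  have /orP[na|na] := normalizedN a; first by exists (a, A).
  by exists (- a, A); split=> //; apply: shortest_opp.
have := count_total d0 hF F0 N0 NM MN MleN H0 dH us ds sP (normal := fun x => (an x).1)
  (normal_norm := fun x => (an x).2) anP.
rewrite -c1E -c2E => /leq_trans; apply; rewrite mulnDr.
apply: leq_add; rewrite leq_mul2r; apply/orP; right; [exact: leq_addr|exact: leq_addl].
Qed.

Lemma integer_points_trivial N (s : seq Z4) : (0 < N)%N -> uniq s ->
  (forall x, x \in s -> norm_le N x) -> (size s <= 81 * N ^ 4)%N.
Proof.
move=> N0 us sP.
have := @uniq_size_inj _ _ s (fun x : Z4 =>
  [ffun i : 'I_4 => inord `|(x 0%R i + N%:Z)%R| : 'I_(2 * N).+1]) us.
rewrite card_ffun !card_ord => H; apply: leq_trans (H _) _; last first.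
  by rewrite -[81%N]/(3 ^ 4)%N -expnMn leq_exp2r //; lia.
move=> x y xs ys e; apply/matrixP => i k; rewrite !ord1.
have := congr1 (fun g : {ffun 'I_4 -> 'I_(2 * N).+1} => (g k : nat)) e; rewrite !ffunE.
have := sP x xs k; have := sP y ys k; move: (x 0 k) (y 0 k) => p q hq hp.
by rewrite !inordK; lia.
Qed.

Section RealBound.
Variable R : realType.

(** Here [h] is the real fourth root of [d].  If h^3 < n, then (h M^2)^3 <= n (8 n)^2
    gives h M^2 <= 4 n, so d M^2 n^2 = h^4 M^2 n^2 <= 4 h^3 n^3. *)
Lemma root_bounds (C n M H sz : nat) (h : R) (d : nat) :
  0 <= h -> h ^+ 4 = d%:R -> (M ^ 3 <= 2 ^ 3 * n)%N -> (H ^ 4 <= 2 ^ 4 * d)%N ->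
  (sz <= C * (d * (M ^ 2 * n ^ 2) + H ^ 3 * n ^ 3))%N -> (sz <= 81 * n ^ 4)%N ->
  sz%:R <= (81 + 12 * C%:R) * (h ^+ 3 * n%:R ^+ 3).
Proof.
move=> h0 hd Mn Hd s1 s2.
have n0 : 0 <= n%:R :> R by rewrite ler0n.
have hn : 0 <= h ^+ 3 * n%:R ^+ 3 :> R by rewrite mulr_ge0 // exprn_ge0.
have [le|lt] := lerP n%:R (h ^+ 3).
  apply: (@le_trans _ _ (81 * (h ^+ 3 * n%:R ^+ 3))).
    have : (sz%:R <= (81 * n ^ 4)%:R :> R) by rewrite ler_nat.
    move=> /le_trans; apply; rewrite natrM natrX ler_wpM2l ?ler0n //.
    by rewrite exprS ler_wpM2r // exprn_ge0.
  by rewrite ler_wpM2r // lerDl mulr_ge0 ?ler0n.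
have Hh : H%:R <= 2 * h.
  rewrite -(@ler_pXn2r _ 4) ?nnegrE ?mulr_ge0 ?ler0n //.
  by rewrite exprMn hd -!natrX -natrM ler_nat.
have H3 : H%:R ^+ 3 <= 8 * h ^+ 3.
  have -> : 8 * h ^+ 3 = (2 * h) ^+ 3 by rewrite exprMn -natrX.
  by rewrite lerXn2r ?nnegrE ?mulr_ge0 ?ler0n.
have hM : h * M%:R ^+ 2 <= 4 * n%:R.
  rewrite -(@ler_pXn2r _ 3) ?nnegrE ?mulr_ge0 ?exprn_ge0 ?ler0n //.
  have -> : (h * M%:R ^+ 2) ^+ 3 = h ^+ 3 * (M%:R ^+ 3) ^+ 2 by rewrite exprMn -!exprM.
  have -> : (4 * n%:R) ^+ 3 = n%:R * (8 * n%:R) ^+ 2 :> R.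
    by clear; move: (n%:R : R) => x; lra.
  apply: ler_pM; rewrite ?exprn_ge0 ?ler0n //; first exact: ltW.
  rewrite lerXn2r ?nnegrE ?exprn_ge0 ?mulr_ge0 ?ler0n //.
  by rewrite -natrX -natrM ler_nat.
have : (sz%:R <= (C * (d * (M ^ 2 * n ^ 2) + H ^ 3 * n ^ 3))%:R :> R) by rewrite ler_nat.
move=> /le_trans; apply.
apply: (@le_trans _ _ (12 * C%:R * (h ^+ 3 * n%:R ^+ 3))); last first.
  by rewrite ler_wpM2r // lerDr.
rewrite natrM natrD (natrM _ d) (natrM _ (M ^ 2)) (natrM _ (H ^ 3)) !natrX -hd.
rewrite [leRHS](_ : _ = C%:R * (12 * (h ^+ 3 * n%:R ^+ 3))); last by rewrite (mulrC 12) -[LHS]mulrA.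
apply: ler_wpM2l; first exact: ler0n.
have -> : 12 * (h ^+ 3 * n%:R ^+ 3) = 4 * (h ^+ 3 * n%:R ^+ 3) + 8 * (h ^+ 3 * n%:R ^+ 3).
  by rewrite -mulrDl -natrD.
apply: lerD; last by rewrite mulrA ler_wpM2r // exprn_ge0.
have -> : h ^+ 4 * (M%:R ^+ 2 * n%:R ^+ 2) = (h * M%:R ^+ 2) * (h ^+ 3 * n%:R ^+ 2).
  by rewrite exprS mulrACA.
have -> : 4 * (h ^+ 3 * n%:R ^+ 3) = (4 * n%:R) * (h ^+ 3 * n%:R ^+ 2).
  by clear; move: (n%:R : R) => x; lra.
by rewrite ler_wpM2r // mulr_ge0 ?exprn_ge0.
Qed.
End RealBound.

Theorem corollary3p7 (R : realType) :
  exists c kappa : R,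
    forall (d : nat) (X : set {mpoly rat[4]}) (B : R),
      (1 <= d)%N -> surface X -> degree X = d%:R -> 2 <= B ->
      finite_set (rational_points_le X B) /\
      (#|` fset_set (rational_points_le X B)|%fset)%:R
        <= c * d%:R `^ (3 / 4) * B ^+ 3 * ln B `^ kappa.
Proof.
have [C HC] := integer_points_bound.
exists (81 + 12 * C%:R), 0 => d X B d1 sX degX B2.
have [F [F0 hF FX]] := surface_form d1 sX degX.
have B0 : 0 <= B by apply: le_trans B2.
have /andP[NB BN] := truncn_itv B0; set N := Num.Def.trunc B in NB BN.
have N0 : (0 < N)%N.
  by rewrite lt0n; apply: contraTneq BN => ->; rewrite -leNgt; apply: le_trans B2; rewrite ler1n.
have /choice[rep repP] : forall p : {vspace 'rV[rat]_4}, exists x : Z4, rational_points_le X B p ->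
    [/\ x != 0, p = <[toQ x]>%VS & norm_le N x].
  move=> p; have [[_ [x [x0 pE xB]]]|np] := pselect (rational_points_le X B p); last by exists 0.
  exists x => _; split=> // i; have := xB i; rewrite -abszE -pmulrn => le.
  by rewrite -ltnS -(ltr_nat R); apply: le_lt_trans le BN.
have fin : finite_set (rational_points_le X B).
  pose f (t : {ffun 'I_4 -> 'I_(2 * N).+1}) : {vspace 'rV[rat]_4} :=
    <[toQ (\row_i ((t i : nat)%:Z - N%:Z))]>%VS.
  apply: (@sub_finite_set _ _ (range f)); last exact: finite_image.
  move=> p /repP[_ pE xN]; exists [ffun i => inord `|(rep p 0%R i + N%:Z)%R|] => //.
  rewrite /f [RHS]pE; congr (<[toQ _]>)%VS; apply/matrixP => i j; rewrite !ord1 mxE ffunE.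
  by have := xN j; move: (rep p 0 j) => q hq; rewrite inordK; lia.
split=> //; set P := fset_set _; pose s := [seq rep p | p <- P].
have inP p : p \in P -> rational_points_le X B p by rewrite in_fset_set // inE.
have repinj : {in P &, injective rep}.
  by move=> p q /inP/repP[_ pE _] /inP/repP[_ qE _] e; rewrite pE qE e.
have us : uniq s by rewrite map_inj_in_uniq // fset_uniq.
have sP x : x \in s -> norm_le N x /\ row_eval F (toQ x) = 0.
  move=> /mapP[p pP ->]; have Xp := inP p pP; have [x0 pE xN] := repP p Xp; split=> //.
  apply: FX; last by case: Xp => -[_ H] _; apply: H; rewrite {2}pE memv_line.
  apply: contrapT => H; case/eqP: x0; apply/matrixP => i j; rewrite ord1 mxE; apply: contrapT => ne.
  by apply: H; exists j; rewrite mxE intr_eq0; apply/eqP.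
have ds : distinct_points s.
  move=> _ _ /mapP[p pP ->] /mapP[q qP ->] ne; apply: contrapT => H.
  have [x0 pE _] := repP p (inP p pP); have [y0 qE _] := repP q (inP q qP).
  case/eqP: ne; congr rep; rewrite pE qE.
  set x := rep p in H x0 *; set y := rep q in H y0 *.
  have mn i j : minor x y i j = 0 by apply: contrapT => /eqP m; apply: H; exists i, j.
  have [i xi] : exists i, x 0 i != 0.
    apply: contrapT => H'; case/eqP: x0; apply/matrixP => i j; rewrite ord1 mxE.
    by apply: contrapT => /eqP z; apply: H'; exists j.
  have xi' : (x 0 i)%:~R != 0 :> rat by rewrite intr_eq0.
  have yE : toQ y = ((y 0 i)%:~R / (x 0 i)%:~R) *: toQ x.
    apply/matrixP => k j; rewrite !ord1 !mxE; apply: (mulfI xi').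
    rewrite [RHS]mulrA (mulrC (x 0 i)%:~R (_ / _)) divfK // -!rmorphM; congr (_%:~R).
    by have /eqP := mn i j; rewrite minorE subr_eq0 => /eqP.
  have r0 : (y 0 i)%:~R / (x 0 i)%:~R != 0 :> rat.
    apply: contraNneq y0 => r0; apply/eqP/matrixP => k j; rewrite ord1 [RHS]mxE.
    apply/eqP; rewrite -(intr_eq0 rat).
    by have := congr1 (fun v : 'rV[rat]_4 => v 0 j) yE; rewrite r0 scale0r !mxE => ->.
  apply/eqP; rewrite eqEsubv -!memvE; apply/andP; split; apply/vlineP.
    by exists ((y 0 i)%:~R / (x 0 i)%:~R)^-1; rewrite yE scalerA mulVf // scale1r.
  by exists ((y 0 i)%:~R / (x 0 i)%:~R).
have [M [M0 NM MN MleN]] := ceil_root N0 (isT : (0 < 3)%N).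
have [H [H0 dH Hd _]] := ceil_root d1 (isT : (0 < 4)%N).
have b1 := HC d N M H F s d1 hF F0 N0 NM MN MleN H0 dH us ds sP.
have b2 := integer_points_trivial N0 us (fun x xs => (sP x xs).1).
pose h : R := d%:R `^ (1 / 4).
have h0 : 0 <= h by apply: powR_ge0.
have hk (k : nat) : h ^+ k = d%:R `^ (k%:R / 4).
  by rewrite -powR_mulrn // /h -powRrM mul1r mulrC.
have h4 : h ^+ 4 = d%:R by rewrite hk divff ?pnatr_eq0 // powRr1 ?ler0n.
have := root_bounds h0 h4 MN Hd b1 b2.
rewrite /s size_map powRr0 mulr1 -hk => /le_trans; apply.
rewrite mulrA; apply: ler_wpM2l.
  by rewrite mulr_ge0 ?exprn_ge0 // addr_ge0 ?mulr_ge0 ?ler0n.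
by rewrite lerXn2r ?nnegrE ?ler0n.
Qed.
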